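(* Let $\mathfrak{g}$ be a Lie ring and $(\mathfrak{g},A)$ a $\mathfrak{g}$-module, with $\mathfrak{g}$, $A$ and the action definable in a finite-dimensional theory. Assume that $\mathfrak{g}$ is nilpotent and that the $0$th almost cohomology group $\widetilde{H}^0(\mathfrak{g},A)$ is finite. Then the $1$st almost cohomology group $\widetilde{H}^1(\mathfrak{g},A)$ is finite.
   Context: Finite-dimensional theory: a first-order theory $T$ with a function $\dim$ from the class of all interpretable sets in models of $T$ to $\omega\cup\{-\infty\}$ such that, for every formula $\phi(x,y)$, all interpretable sets $X,Y$ and every interpretable function $f:X\to Y$: (Invariance) if $a,a'$ have the same type over $\emptyset$ then $\dim\phi(x,a)=\dim\phi(x,a')$; (Algebraicity) $\dim\emptyset=-\infty$, and $\dim X=0$ iff $X$ is finite (nonempty); (Union) $\dim(X\cup Y)=\max\{\dim X,\dim Y\}$; (Upper Fibration) if $\dim f^{-1}(y)\ge k$ for all $y\in Y$ then $\dim X\ge\dim Y+k$; (Lower Fibration) if $\dim f^{-1}(y)\le k$ for all $y\in Y$ then $\dim X\le \dim Y+k$. An object is definable in a finite-dimensional theory if it is definable in a model of such a theory. Lie ring: an abelian group $(\mathfrak{g},+)$ with a bilinear, antisymmetric bracket satisfying the Jacobi identity; for $g\in\mathfrak g$, $\mathrm{ad}_g(x)=[g,x]$. It is nilpotent if there is a chain of ideals $\mathfrak g=\mathfrak g_0\ge\mathfrak g_1\ge\dots\ge\mathfrak g_n=0$ with $[\mathfrak g,\mathfrak g_i]\le\mathfrak g_{i+1}$ for $i<n$.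 A $\mathfrak g$-module is an abelian group $A$ with a map $\mathfrak g\times A\to A$ inducing a homomorphism of Lie rings $\mathfrak g\to\mathrm{End}(A)$, where $\mathrm{End}(A)$ has bracket $fh-hf$. Almost cohomology. A partial homomorphism from $\mathfrak g$ to $A$ is a group homomorphism $f:\mathrm{Dom}(f)\to A$ with $\mathrm{Dom}(f)$ a subgroup of finite index in $(\mathfrak g,+)$. The sum $f+f_1$ is defined pointwise on $\mathrm{Dom}(f)\cap\mathrm{Dom}(f_1)$, and $-f$ pointwise on $\mathrm{Dom}(f)$. Write $f\sim f_1$ if $(f-f_1)(\mathrm{Dom}(f)\cap\mathrm{Dom}(f_1))$ is finite. Set $\widetilde C^0(\mathfrak g,A)=A$ and $\widetilde C^1(\mathfrak g,A)=\{\text{partial homomorphisms}\}/\sim$, which is a group under $+$. The differential $d:\widetilde C^0(\mathfrak g,A)\to\widetilde C^1(\mathfrak g,A)$ sends $a$ to the class of $d(a):g\mapsto g\cdot a$. For a partial homomorphism $f$ and $g\in\mathrm{Dom}(f)$, let $D^f_g=\{g'\in\mathrm{Dom}(f)\cap\mathrm{ad}_g^{-1}(\mathrm{Dom}(f)) : f([g,g'])=g\cdot f(g')-g'\cdot f(g)\}$ and $D^f=\{g\in\mathrm{Dom}(f): D^f_g \text{ has finite index in }\mathfrak g\}$. Then $f$ is an almost derivation if $D^f$ has finite index in $\mathfrak g$; $\mathrm{AlmDer}(\mathfrak g,A)\le\widetilde C^1(\mathfrak g,A)$ is the subgroup of classes of almost derivations. Define $\widetilde H^0(\mathfrak g,A)=\ker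 d$ (equivalently, $\{a\in A:\mathfrak g\cdot a\text{ is finite}\}$) and $\widetilde H^1(\mathfrak g,A)=\mathrm{AlmDer}(\mathfrak g,A)/\mathrm{im}(d)$. *)

(* Defs.v *)
From HB Require Import structures.
From mathcomp Require Import all_boot all_order all_algebra.
From mathcomp Require Import boolp classical_sets functions cardinality.
Set Implicit Arguments.
Unset Strict Implicit.
Unset Printing Implicit Defensive.
Import GRing.Theory.
Import quotient.
Local Open Scope classical_set_scope.
Local Open Scope quotient_scope.
Local Open Scope ring_scope.

Record language := Language {
  fun_symb : Type;
  fun_arity : fun_symb -> nat;
  rel_symb : Type;
  rel_arity : rel_symb -> nat }.

(** One-sorted logic: terms and formulas with free variables among [n] de Bruijn indices; [fAll]
    binds the variable of index 0. The other connectives are derived. *)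
Inductive term (L : language) (n : nat) : Type :=
| tVar of 'I_n
| tFun (f : fun_symb L) of ('I_(fun_arity f) -> term L n).

Inductive formula (L : language) : nat -> Type :=
| fFalse n : formula L n
| fEq n of term L n & term L n : formula L n
| fRel n (r : rel_symb L) of ('I_(rel_arity r) -> term L n) : formula L n
| fImp n of formula L n & formula L n : formula L n
| fAll n of formula L n.+1 : formula L n.

Record structure (L : language) := Structure {
  carrier :> Type;
  carrier_inhabited : inhabited carrier;
  fun_interp : forall f : fun_symb L, (fun_arity f).-tuple carrier -> carrier;
  rel_interp : forall r : rel_symb L, (rel_arity r).-tuple carrier -> Prop }.

Fixpoint eval (L : language) (M : structure L) (n : nat) (v : n.-tuple M)
    (t : term L n) : M :=
  match t with
  | tVar i => tnth v i
  | tFun f ts => fun_interp [tuple eval v (ts i) | i < fun_arity f]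
  end.

Fixpoint sat (L : language) (M : structure L) (n : nat) (phi : formula L n) :
    n.-tuple M -> Prop :=
  match phi in formula _ n return n.-tuple M -> Prop with
  | fFalse _ => fun=> False
  | fEq _ t u => fun v => eval v t = eval v u
  | fRel _ r ts => fun v => rel_interp [tuple eval v (ts i) | i < rel_arity r]
  | fImp _ phi psi => fun v => sat phi v -> sat psi v
  | fAll _ phi => fun v => forall x : M, sat phi [tuple of x :: v]
  end.

Definition theory (L : language) := set (formula L 0).

Definition models (L : language) (T : theory L) (M : structure L) :=
  forall phi, T phi -> sat phi [tuple of [::] : seq M].

(** Equality of types over the empty set, for tuples that may live in different
    models. *)
Definition same_type (L : language) (M M' : structure L) (k : nat)
    (a : k.-tuple M) (a' : k.-tuple M') :=
  forall phi : formula L k, sat phi a <-> sat phi a'.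

Definition defset (L : language) (M : structure L) (n k : nat)
    (phi : formula L (n + k)) (a : k.-tuple M) : set (n.-tuple M) :=
  [set x : n.-tuple M | sat phi [tuple of x ++ a]].

Definition definable (L : language) (M : structure L) (n : nat)
    (D : set (n.-tuple M)) :=
  exists k (phi : formula L (n + k)) (a : k.-tuple M), D = defset phi a.

Definition equivalence_on (X : Type) (D : set X) (E : X -> X -> Prop) :=
  [/\ forall x, D x -> E x x,
      forall x y, D x -> D y -> E x y -> E y x &
      forall x y z, D x -> D y -> D z -> E x y -> E y z -> E x z].

(** The set [D / E] of classes, so that a set interpretable in [M] is literally
    a set of (definable) subsets of some cartesian power of [M]. *)
Definition quotient_set (X : Type) (D : set X) (E : X -> X -> Prop) :
    set (set X) :=
  [set [set y | D y /\ E x y] | x in D].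

Definition defrel (L : language) (M : structure L) (n k : nat)
    (eps : formula L (n + n + k)) (a : k.-tuple M) (x y : n.-tuple M) : Prop :=
  defset eps a [tuple of x ++ y].

Definition interpretable (L : language) (M : structure L) (n : nat)
    (X : set (set (n.-tuple M))) :=
  exists k (delta : formula L (n + k)) (eps : formula L (n + n + k))
    (a : k.-tuple M),
    equivalence_on (defset delta a) (defrel eps a) /\
    X = quotient_set (defset delta a) (defrel eps a).

Definition interpretable_fun (L : language) (M : structure L) (n m : nat)
    (X : set (set (n.-tuple M))) (Y : set (set (m.-tuple M)))
    (f : set (n.-tuple M) -> set (m.-tuple M)) :=
  (forall x, X x -> Y (f x)) /\
  definable [set w : (n + m).-tuple M | exists (x : set (n.-tuple M)) (u : n.-tuple M) (v : m.-tuple M),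
    [/\ X x, x u, f x v & w = [tuple of u ++ v]]].

(** Values in [omega] with a least element -oo, represented by [None]. *)
Definition dimension := option nat.

Definition dim_le (u v : dimension) : Prop :=
  match u, v with
  | None, _ => True
  | Some _, None => False
  | Some a, Some b => (a <= b)%N
  end.

Definition dim_max (u v : dimension) : dimension :=
  match u, v with
  | None, _ => v
  | _, None => u
  | Some a, Some b => Some (maxn a b)
  end.

Definition dim_add (u : dimension) (k : nat) : dimension :=
  omap (fun a => a + k)%N u.

(** [dim] is a total function on sets of subsets of the powers of all
    structures; only its values on interpretable sets in models of [T] are
    constrained.
    - In [dim_invariance], the interpretable set defined by an arbitrary formula
      with parameters [a] is given by formulas for its domain and for the
      equivalence relation; equality of types makes the relation defined by [a']
      an equivalence as well.
    - In [dim_union], that the union is interpretable means that [X] and [Y] are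
      subsets of one interpretable sort. *)
Record dimension_on (L : language) (T : theory L)
    (dim : forall (M : structure L) (n : nat),
      set (set (n.-tuple M)) -> dimension) : Prop := {
  dim_invariance : forall (M M' : structure L), models T M -> models T M' ->
    forall n k (delta : formula L (n + k)) (eps : formula L (n + n + k))
      (a : k.-tuple M) (a' : k.-tuple M'),
    same_type a a' ->
    equivalence_on (defset delta a) (defrel eps a) ->
    dim M n (quotient_set (defset delta a) (defrel eps a)) =
    dim M' n (quotient_set (defset delta a') (defrel eps a'));
  dim_empty : forall M : structure L, models T M ->
    forall n, dim M n set0 = None;
  dim_algebraicity : forall M : structure L, models T M ->
    forall n (X : set (set (n.-tuple M))), interpretable X ->
    dim M n X = Some 0%N <-> finite_set X /\ X !=set0;
  dim_union : forall M : structure L, models T M ->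
    forall n (X Y : set (set (n.-tuple M))),
    interpretable X -> interpretable Y -> interpretable (X `|` Y) ->
    dim M n (X `|` Y) = dim_max (dim M n X) (dim M n Y);
  dim_upper_fibration : forall M : structure L, models T M ->
    forall n m (X : set (set (n.-tuple M))) (Y : set (set (m.-tuple M))) f k,
    interpretable X -> interpretable Y -> interpretable_fun X Y f ->
    (forall y, Y y -> dim_le (Some k) (dim M n (X `&` f @^-1` [set y]))) ->
    dim_le (dim_add (dim M m Y) k) (dim M n X);
  dim_lower_fibration : forall M : structure L, models T M ->
    forall n m (X : set (set (n.-tuple M))) (Y : set (set (m.-tuple M))) f k,
    interpretable X -> interpretable Y -> interpretable_fun X Y f ->
    (forall y, Y y -> dim_le (dim M n (X `&` f @^-1` [set y])) (Some k)) ->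
    dim_le (dim M n X) (dim_add (dim M m Y) k) }.

Definition finite_dimensional (L : language) (T : theory L) :=
  exists dim, dimension_on T dim.

HB.mixin Record Zmodule_isLieRing g of GRing.Zmodule g := {
  lie : g -> g -> g;
  lieDl : forall x y z : g, lie (x + y) z = lie x z + lie y z;
  lieDr : forall x y z : g, lie x (y + z) = lie x y + lie x z;
  lie_antisym : forall x y : g, lie x y = - lie y x;
  lie_jacobi : forall x y z : g,
    lie x (lie y z) + lie y (lie z x) + lie z (lie x y) = 0 }.

#[short(type="lieRingType")]
HB.structure Definition LieRing := {g of GRing.Zmodule g & Zmodule_isLieRing g}.

HB.mixin Record Zmodule_isLieModule (g : lieRingType) A of GRing.Zmodule A := {
  act : g -> A -> A;
  actDl : forall (x y : g) (a : A), act (x + y) a = act x a + act y a;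
  actDr : forall (x : g) (a b : A), act x (a + b) = act x a + act x b;
  act_lie : forall (x y : g) (a : A),
    act (lie x y) a = act x (act y a) - act y (act x a) }.

#[short(type="lieModType")]
HB.structure Definition LieModule (g : lieRingType) :=
  {A of GRing.Zmodule A & Zmodule_isLieModule g A}.

Definition additive_subgroup (V : zmodType) (H : set V) :=
  H 0 /\ forall x y, H x -> H y -> H (x - y).

Definition lie_ideal (g : lieRingType) (I : set g) :=
  additive_subgroup I /\ forall x y : g, I y -> I (lie x y).

Definition lie_nilpotent (g : lieRingType) :=
  exists (n : nat) (I : nat -> set g),
    [/\ I 0%N = setT, I n = [set 0],
        forall i, (i <= n)%N -> lie_ideal (I i),
        forall i, (i < n)%N -> I i.+1 `<=` I i &
        forall i, (i < n)%N -> forall x y : g, I i y -> I i.+1 (lie x y)].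

(** An abstract set is definable in [M] through a bijection with a definable
    set, an operation when its graph read through these bijections is. *)
Definition definable_coding (L : language) (M : structure L) (X : Type)
    (n : nat) (c : X -> n.-tuple M) :=
  injective c /\ definable (range c).

Definition definable_op (L : language) (M : structure L) (X Y Z : Type)
    (n m p : nat) (cX : X -> n.-tuple M) (cY : Y -> m.-tuple M)
    (cZ : Z -> p.-tuple M) (op : X -> Y -> Z) :=
  definable [set w : (n + m + p).-tuple M | exists x y,
    w = [tuple of [tuple of cX x ++ cY y] ++ cZ (op x y)]].

Record definable_coded (L : language) (M : structure L) (g : lieRingType)
    (A : lieModType g) (n m : nat) (cg : g -> n.-tuple M)
    (cA : A -> m.-tuple M) : Prop := {
  definable_ring : definable_coding cg;
  definable_mod : definable_coding cA;
  definable_ring_add : definable_op cg cg cg (fun x y : g => x + y);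
  definable_ring_lie : definable_op cg cg cg (@lie g);
  definable_mod_add : definable_op cA cA cA (fun a b : A => a + b);
  definable_act : definable_op cg cA cA (@act g A) }.

Definition definable_lie_module (L : language) (M : structure L)
    (g : lieRingType) (A : lieModType g) :=
  exists n m (cg : g -> n.-tuple M) (cA : A -> m.-tuple M),
    definable_coded cg cA.

Definition cosets (V : zmodType) (H S : set V) : set (set V) :=
  [set [set x + h | h in H] | x in S].

Definition finite_index (V : zmodType) (H : set V) :=
  finite_set (cosets H setT).

(** The values of [pmap] outside [pdom] are irrelevant. *)
Record partial_hom (g A : zmodType) := PartialHom {
  pdom : set g;
  pmap :> g -> A;
  pdom_subgroup : additive_subgroup pdom;
  pdom_finite_index : finite_index pdom;
  pmapD : forall x y, pdom x -> pdom y -> pmap (x + y) = pmap x + pmap y }.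

HB.instance Definition _ (g A : zmodType) := gen_eqMixin (partial_hom g A).
HB.instance Definition _ (g A : zmodType) := gen_choiceMixin (partial_hom g A).

Lemma additive_subgroupT (V : zmodType) : additive_subgroup [set: V].
Proof. by []. Qed.

Lemma finite_indexT (V : zmodType) : finite_index [set: V].
Proof.
apply: (@sub_finite_set _ _ [set setT]); last exact: finite_set1.
move=> _ [x _ <-]; apply/seteqP; split=> // y _.
by exists (y - x) => //; rewrite addrC subrK.
Qed.

Lemma additive_subgroupI (V : zmodType) (H K : set V) :
  additive_subgroup H -> additive_subgroup K -> additive_subgroup (H `&` K).
Proof. by move=> [H0 HB] [K0 KB]; split=> // x y [? ?] [? ?]; split; auto. Qed.

Lemma finite_indexI (V : zmodType) (H K : set V) :
  finite_index H -> finite_index K -> finite_index (H `&` K).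
Proof.
move=> fH fK; apply: sub_finite_set (finite_image2 setI fH fK).
move=> _ [x _ <-].
exists [set x + h | h in H]; first by exists x.
exists [set x + h | h in K]; first by exists x.
apply/seteqP; split=> y.
  by move=> [[h Hh <-] [h' Kh' /addrI e]]; exists h => //; split=> //; rewrite -e.
by move=> [h [Hh Kh] <-]; split; exists h.
Qed.

Lemma additive_subgroupN (V : zmodType) (H : set V) x :
  additive_subgroup H -> H x -> H (- x).
Proof. by move=> [H0 HB] Hx; rewrite -sub0r; apply: HB. Qed.

Lemma additive_subgroupD (V : zmodType) (H : set V) x y :
  additive_subgroup H -> H x -> H y -> H (x + y).
Proof.
by move=> sH Hx Hy; rewrite -[y]opprK; apply: sH.2 => //; apply: additive_subgroupN.
Qed.

Lemma phom_add_subproof (g A : zmodType) (f f1 : partial_hom g A) (x y : g) :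
  (pdom f `&` pdom f1) x -> (pdom f `&` pdom f1) y ->
  f (x + y) + f1 (x + y) = (f x + f1 x) + (f y + f1 y).
Proof. by move=> [? ?] [? ?]; rewrite !pmapD// addrACA. Qed.

Definition phom_add (g A : zmodType) (f f1 : partial_hom g A) :
    partial_hom g A :=
  @PartialHom g A (pdom f `&` pdom f1) (fun x => f x + f1 x)
    (additive_subgroupI (pdom_subgroup f) (pdom_subgroup f1))
    (finite_indexI (pdom_finite_index f) (pdom_finite_index f1))
    (@phom_add_subproof g A f f1).

Lemma phom_opp_subproof (g A : zmodType) (f : partial_hom g A) (x y : g) :
  pdom f x -> pdom f y -> - f (x + y) = - f x + - f y.
Proof. by move=> ? ?; rewrite pmapD// opprD. Qed.

Definition phom_opp (g A : zmodType) (f : partial_hom g A) : partial_hom g A :=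
  @PartialHom g A (pdom f) (fun x => - f x)
    (pdom_subgroup f) (pdom_finite_index f) (@phom_opp_subproof g A f).

Lemma phom_zero_subproof (g A : zmodType) (x y : g) :
  setT x -> setT y -> 0 = 0 + 0 :> A.
Proof. by rewrite addr0. Qed.

Definition phom_zero (g A : zmodType) : partial_hom g A :=
  @PartialHom g A setT (fun=> 0) (additive_subgroupT g) (finite_indexT g)
    (@phom_zero_subproof g A).

Definition almost_eq (g A : zmodType) : rel (partial_hom g A) := fun f f1 =>
  `[< finite_set [set phom_add f (phom_opp f1) x | x in pdom f `&` pdom f1] >].

(* A partial homomorphism with finite image on a finite-index subgroup of its
   domain has finite image. *)
Lemma finite_image_phom (g A : zmodType) (f : partial_hom g A) (K : set g) :
  additive_subgroup K -> finite_index K ->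
  finite_set [set f x | x in pdom f `&` K] -> finite_set [set f x | x in pdom f].
Proof.
move=> sK fK fin.
pose F (c : set g) := [set f x | x in pdom f `&` [set x | [set x + h | h in K] = c]].
apply: (@sub_finite_set _ _ (\bigcup_(c in cosets K setT) F c)).
  move=> _ [x Dx <-]; exists [set x + h | h in K]; first by exists x.
  by exists x.
apply: bigcup_finite fK _ => c _.
have [[r [Dr rc]]|nr] :=
    pselect (exists r, pdom f r /\ [set r + h | h in K] = c); last first.
  rewrite (_ : F c = set0); first exact: finite_set0.
  by apply/seteqP; split=> // y [x [Dx xc] _]; apply: nr; exists x.
apply: sub_finite_set (finite_image (fun a => f r + a) fin).
move=> _ [x [Dx xc] <-].
have [h Kh xE] : [set r + h | h in K] x.
  by rewrite rc -xc; exists 0; [exact: sK.1 | rewrite addr0].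
have Dh : pdom f h.
  have -> : h = x - r by rewrite -xE addrC addKr.
  exact: (pdom_subgroup f).2.
by exists (f h); [exists h | rewrite -pmapD// xE].
Qed.

Lemma almost_eq_refl (g A : zmodType) : reflexive (@almost_eq g A).
Proof.
move=> f; apply/asboolP; apply: (@sub_finite_set _ _ [set 0]).
  by move=> _ [x _ <-] /=; rewrite subrr.
exact: finite_set1.
Qed.

Lemma almost_eq_imp_sym (g A : zmodType) (f f1 : partial_hom g A) :
  almost_eq f f1 -> almost_eq f1 f.
Proof.
move=> /asboolP fin; apply/asboolP.
apply: sub_finite_set (finite_image -%R fin).
move=> _ [x [Dx D1x] <-]; exists (phom_add f (phom_opp f1) x); first by exists x.
by rewrite /= opprB.
Qed.

Lemma almost_eq_sym (g A : zmodType) : symmetric (@almost_eq g A).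
Proof. by move=> f f1; apply/idP/idP; apply: almost_eq_imp_sym. Qed.

Lemma almost_eq_trans (g A : zmodType) : transitive (@almost_eq g A).
Proof.
move=> f1 f f2 /asboolP fin /asboolP fin1; apply/asboolP.
apply: (@finite_image_phom _ _ (phom_add f (phom_opp f2)) (pdom f1)).
- exact: pdom_subgroup.
- exact: pdom_finite_index.
apply: sub_finite_set (finite_image2 +%R fin fin1).
move=> _ [x [[Dx D2x] D1x] <-] /=.
exists (f x - f1 x); first by exists x.
exists (f1 x - f2 x); first by exists x.
by rewrite addrA subrK.
Qed.

Canonical almost_eq_equiv (g A : zmodType) :=
  EquivRel (@almost_eq g A) (@almost_eq_refl g A) (@almost_eq_sym g A)
    (@almost_eq_trans g A).

Definition almost_C1 (g A : zmodType) := {eq_quot (@almost_eq g A)}.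
HB.instance Definition _ (g A : zmodType) := EqQuotient.on (almost_C1 g A).
HB.instance Definition _ (g A : zmodType) := Choice.on (almost_C1 g A).

Definition C1_class (g A : zmodType) (f : partial_hom g A) : almost_C1 g A :=
  \pi_(almost_C1 g A) f.

Lemma C1_classP (g A : zmodType) (f f1 : partial_hom g A) :
  C1_class f = C1_class f1 <->
  finite_set [set f x - f1 x | x in pdom f `&` pdom f1].
Proof.
by split=> [/eqP|fin]; [rewrite eqmodE => /asboolP | apply/eqP; rewrite eqmodE; apply/asboolP].
Qed.

Definition C1_add (g A : zmodType) (u v : almost_C1 g A) : almost_C1 g A :=
  C1_class (phom_add (repr u) (repr v)).
Definition C1_opp (g A : zmodType) (u : almost_C1 g A) : almost_C1 g A :=
  C1_class (phom_opp (repr u)).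
Definition C1_zero (g A : zmodType) : almost_C1 g A :=
  C1_class (phom_zero g A).

Lemma C1_class_repr (g A : zmodType) (u : almost_C1 g A) : C1_class (repr u) = u.
Proof. exact: reprK. Qed.

Lemma C1_addE (g A : zmodType) (f f1 : partial_hom g A) :
  C1_add (C1_class f) (C1_class f1) = C1_class (phom_add f f1).
Proof.
have /C1_classP fin := C1_class_repr (C1_class f).
have /C1_classP fin1 := C1_class_repr (C1_class f1).
apply/C1_classP; apply: sub_finite_set (finite_image2 +%R fin fin1).
move=> _ [x [[Dx D1x] [Ex E1x]] <-].
exists (repr (C1_class f) x - f x); first by exists x.
exists (repr (C1_class f1) x - f1 x); first by exists x.
by rewrite /= opprD addrACA.
Qed.

Lemma C1_oppE (g A : zmodType) (f : partial_hom g A) :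
  C1_opp (C1_class f) = C1_class (phom_opp f).
Proof.
have /C1_classP fin := C1_class_repr (C1_class f).
apply/C1_classP; apply: sub_finite_set (finite_image -%R fin).
move=> _ [x [Dx Ex] <-].
by exists (repr (C1_class f) x - f x); [exists x | rewrite /= opprD].
Qed.

Lemma C1_class_ext (g A : zmodType) (f f1 : partial_hom g A) :
  (forall x, pdom f x -> pdom f1 x -> f x = f1 x) -> C1_class f = C1_class f1.
Proof.
move=> e; apply/C1_classP; apply: (@sub_finite_set _ _ [set 0]).
  by move=> _ [x [Dx D1x] <-] /=; rewrite e// subrr.
exact: finite_set1.
Qed.

Lemma C1_addA (g A : zmodType) : associative (@C1_add g A).
Proof.
move=> u v w; rewrite -(C1_class_repr u) -(C1_class_repr v) -(C1_class_repr w).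
by rewrite !C1_addE; apply: C1_class_ext => x _ _ /=; rewrite addrA.
Qed.

Lemma C1_addC (g A : zmodType) : commutative (@C1_add g A).
Proof.
move=> u v; rewrite -(C1_class_repr u) -(C1_class_repr v) !C1_addE.
by apply: C1_class_ext => x _ _ /=; rewrite addrC.
Qed.

Lemma C1_add0 (g A : zmodType) : left_id (C1_zero g A) (@C1_add g A).
Proof.
move=> u; rewrite -[in LHS](C1_class_repr u) -[in RHS](C1_class_repr u) C1_addE.
by apply: C1_class_ext => x _ _ /=; rewrite add0r.
Qed.

Lemma C1_addN (g A : zmodType) :
  left_inverse (C1_zero g A) (@C1_opp g A) (@C1_add g A).
Proof.
move=> u; rewrite -(C1_class_repr u) C1_oppE C1_addE.
by apply: C1_class_ext => x _ _ /=; rewrite addNr.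
Qed.

HB.instance Definition _ (g A : zmodType) :=
  GRing.isZmodule.Build (almost_C1 g A)
    (@C1_addA g A) (@C1_addC g A) (@C1_add0 g A) (@C1_addN g A).

Definition inner_phom (g : lieRingType) (A : lieModType g) (a : A) :
    partial_hom g A :=
  @PartialHom g A setT (fun x : g => act x a) (additive_subgroupT g)
    (finite_indexT g) (fun x y _ _ => actDl x y a).

Definition almost_d (g : lieRingType) (A : lieModType g) (a : A) :
    almost_C1 g A :=
  C1_class (inner_phom a).

(** [Dder2 f x] is D^f_x and [Dder f] is D^f; both are additive subgroups, so
    that counting translates in [finite_index] is counting cosets. *)
Definition Dder2 (g : lieRingType) (A : lieModType g) (f : partial_hom g A)
    (x : g) : set g :=
  [set y | [/\ pdom f y, pdom f (lie x y) &
               f (lie x y) = act x (f y) - act y (f x)]].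

Definition Dder (g : lieRingType) (A : lieModType g) (f : partial_hom g A) :
    set g :=
  [set x | pdom f x /\ finite_index (Dder2 f x)].

Definition almost_derivation (g : lieRingType) (A : lieModType g)
    (f : partial_hom g A) :=
  finite_index (Dder f).

Definition AlmDer (g : lieRingType) (A : lieModType g) : set (almost_C1 g A) :=
  [set C1_class f | f in [set f : partial_hom g A | almost_derivation f]].
Arguments AlmDer {g} A _ : rename.

Definition almost_H0 (g : lieRingType) (A : lieModType g) : set A :=
  [set a | almost_d a = 0].
Arguments almost_H0 {g} A _ : rename.

(** The quotient group AlmDer / im d, as the set of cosets of im d. *)
Definition almost_H1 (g : lieRingType) (A : lieModType g) :
    set (set (almost_C1 g A)) :=
  cosets (range (@almost_d g A)) (AlmDer A).
Arguments almost_H1 {g} A _ : rename.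

(* Main.v *)
(** Dividing [A] by the finite submodule [almost_H0 A], one may assume that only
    [0] is almost invariant. Let [d] and [al] be the dimensions of [g] and [A]. In
    the semidirect product [s] of [g] and [A], the graph of an almost derivation [f]
    is almost a Lie subring, which we recover from finitely many of its elements: a
    dimension count shows that for [n = al + 1] the generic [n]-tuple [k] of [g] has
    trivial common kernel in [A], so that [k] can be chosen in any given subgroup of
    finite index; then the graph of [f] lies, up to finite index, in the Fitting
    null component of the nilpotent operators [ad (k i, f (k i))] on [s].

    Call Cartan family a tuple [K] of [s] with trivial common kernel in [A] which is
    contained in its own null component [R]. By the Fitting decomposition [R]
    projects injectively onto a subgroup of finite index of [g], and the Cartan
    families over a fixed tuple of [g] form a set of dimension at most [al]; hence
    the Cartan families have dimension at most [n d + al]. Identify families whose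
    null components are conjugate under the automorphisms [exp (ad a)], for [a] in
    [A], that is, differ by a coboundary. Every class has dimension at least
    [n d + al], as it contains the conjugates of the generic tuples of [R]. By
    fibration the classes are finitely many, although [f] and its domain need not be
    definable. *)

(* The obstacle is that an almost derivation is an arbitrary map, out of reach of the dimension,
   whereas a null component is defined by the parameters [K] alone. It pins the map down because
   words of length [c] in [g] vanish: word operators of length [c] send the semidirect product into
   [A], and a tuple with trivial common kernel leaves no nonzero null vector there. So [nullc K]
   meets [A] trivially and is the graph of a map on a subgroup of [g].

   Nilpotency of a family of operators is always understood for all iterated brackets at once, since
   in positive characteristic the generators alone say too little. This is why a Cartan family must
   lie in its own null component: the bracket words of the [sbr (K i)] are then zero from length [c]
   on.

   The two occurrences of [al] have one source. Conjugation by [A] moves a family over a fixed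
   injective tuple along a copy of [A], and finitely many translates of this copy contain all Cartan
   families over that tuple. *)
Require Import Defs.
From HB Require Import structures.
From mathcomp Require Import all_boot all_order all_algebra.
From mathcomp Require Import boolp classical_sets functions cardinality.
Set Implicit Arguments.
Unset Strict Implicit.
Unset Printing Implicit Defensive.
Import GRing.Theory.
Local Open Scope classical_set_scope.
Local Open Scope ring_scope.

(** * Definable sets over interpretable sorts *)

Section Definability.
Variables (L : language) (M : structure L).

Fixpoint tren m n (r : 'I_m -> 'I_n) (t : term L m) : term L n :=
  match t with
  | tVar i => tVar L (r i)
  | tFun f ts => tFun (fun i => tren r (ts i))
  end.

Lemma eval_tren m n (r : 'I_m -> 'I_n) (t : term L m) (v : n.-tuple M) :
  eval v (tren r t) = eval [tuple tnth v (r i) | i < m] t.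
Proof.
elim: t => [i|f ts IH] /=; first by rewrite tnth_mktuple.
by congr fun_interp; apply: eq_from_tnth => i; rewrite !tnth_mktuple IH.
Qed.

Definition rlift m n (r : 'I_m -> 'I_n) (i : 'I_m.+1) : 'I_n.+1 :=
  if unlift ord0 i is Some j then lift ord0 (r j) else ord0.

Fixpoint fren m (phi : formula L m) : forall n, ('I_m -> 'I_n) -> formula L n :=
  match phi in formula _ m return forall n, ('I_m -> 'I_n) -> formula L n with
  | fFalse _ => fun n r => fFalse L n
  | fEq _ t u => fun n r => fEq (tren r t) (tren r u)
  | fRel _ R ts => fun n r => fRel (fun i => tren r (ts i))
  | fImp _ phi psi => fun n r => fImp (fren phi r) (fren psi r)
  | fAll _ phi => fun n r => fAll (fren phi (rlift r))
  end.

Lemma sat_fren m (phi : formula L m) n (r : 'I_m -> 'I_n) (v : n.-tuple M) :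
  sat (fren phi r) v <-> sat phi [tuple tnth v (r i) | i < m].
Proof.
elim: phi n r v => {m} [m|m t u|m R ts|m phi IH psi IH'|m phi IH] n r v //=.
- by rewrite !eval_tren.
- set a := [tuple _ | _ < _]; set b := [tuple _ | _ < _].
  suff -> : a = b by [].
  by apply: eq_from_tnth => i; rewrite !tnth_mktuple eval_tren.
- by rewrite IH IH'.
- have E x : [tuple tnth [tuple of x :: v] (rlift r i) | i < m.+1] =
      [tuple of x :: [tuple tnth v (r i) | i < m]].
    apply: eq_from_tnth => i; rewrite tnth_mktuple /rlift.
    case: unliftP => [j ->|->]; last by rewrite !tnth0.
    by rewrite !tnthS tnth_mktuple.
  by split=> h x; move: (h x); rewrite IH E.
Qed.

Definition fEx n (phi : formula L n.+1) : formula L n :=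
  fImp (fAll (fImp phi (fFalse L _))) (fFalse L n).

Lemma sat_fEx n (phi : formula L n.+1) (v : n.-tuple M) :
  sat (fEx phi) v <-> exists x, sat phi [tuple of x :: v].
Proof.
split=> [h|[x hx] h]; last exact: (h x).
by apply: contrapT => nh; apply: h => x hx; apply: nh; exists x.
Qed.

Fixpoint fExn k n : formula L (k + n) -> formula L n :=
  match k return formula L (k + n) -> formula L n with
  | 0%N => id
  | k'.+1 => fun phi => @fExn k' n (fEx phi)
  end.

Lemma sat_fExn k n (phi : formula L (k + n)) (v : n.-tuple M) :
  sat (fExn phi) v <-> exists w : k.-tuple M, sat phi [tuple of w ++ v].
Proof.
elim: k phi => [|k IH] phi /=.
  split=> [h|[w]]; first by exists [tuple]; rewrite (_ : [tuple of _] = v) //; apply: val_inj.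
  by rewrite (_ : [tuple of _] = v) //; apply: val_inj => /=; rewrite (tuple0 w).
rewrite IH; split=> [[w /sat_fEx[x hx]]|[w]].
  exists [tuple of x :: w]; rewrite (_ : [tuple of _] = [tuple of x :: [tuple of w ++ v]]) //.
  exact: val_inj.
case/tupleP: w => x w hx; exists w; apply/sat_fEx; exists x.
by rewrite (_ : [tuple of _ :: _] = [tuple of [tuple of x :: w] ++ v]) //; apply: val_inj.
Qed.

(** Variables are indexed by an arbitrary type [I], so that tuples of variables
    can be concatenated and reindexed without arithmetic on lengths. *)
Definition asg (I : Type) (e : I -> M) (s : I + M) : M :=
  match s with inl i => e i | inr a => a end.

(** The parameters are the elements of [M] that [rho] takes as values, so predicates can be combined
    without merging tuples of parameters. *)
Definition defpred (I : Type) (P : (I -> M) -> Prop) :=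
  exists m (phi : formula L m) (rho : 'I_m -> I + M),
    forall e, P e <-> sat phi [tuple asg e (rho i) | i < m].

Definition sumf (I J N : Type) (e : I -> N) (e' : J -> N) (s : I + J) : N :=
  match s with inl i => e i | inr j => e' j end.

Lemma defpred_ext (I : Type) (P Q : (I -> M) -> Prop) :
  (forall e, P e <-> Q e) -> defpred P -> defpred Q.
Proof. by move=> PQ [m [phi [rho h]]]; exists m, phi, rho => e; rewrite -PQ. Qed.

Lemma defpred_subst (I J : Type) (rho : J -> I + M) (P : (J -> M) -> Prop) :
  defpred P -> defpred (fun e : I -> M => P (fun j => asg e (rho j))).
Proof.
move=> [m [phi [rho' h]]].
exists m, phi, (fun i => match rho' i with inl j => rho j | inr a => inr a end) => e.
rewrite h; set a := [tuple _ | _ < _]; set b := [tuple _ | _ < _].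
suff -> : a = b by [].
by apply: eq_from_tnth => i; rewrite !tnth_mktuple; case: (rho' i).
Qed.

Lemma defpred_reindex (I J : Type) (rho : J -> I) (P : (J -> M) -> Prop) :
  defpred P -> defpred (fun e : I -> M => P (fun j => e (rho j))).
Proof. exact: (@defpred_subst I J (fun j => inl (rho j))). Qed.

Lemma defpred_False (I : Type) : defpred (fun e : I -> M => False).
Proof.
have z (i : 'I_0) : I + M by case: i.
by exists 0%N, (fFalse L 0), z.
Qed.

Lemma defpred_imp (I : Type) (P Q : (I -> M) -> Prop) :
  defpred P -> defpred Q -> defpred (fun e => P e -> Q e).
Proof.
move=> [m [phi [r h]]] [m' [phi' [r' h']]].
pose rho (i : 'I_(m + m')) := match fintype.split i with inl j => r j | inr j => r' j end.
exists (m + m')%N, (fImp (fren phi (@lshift m m')) (fren phi' (@rshift m m'))), rho => e /=.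
rewrite !sat_fren h h'; set v := [tuple asg e (rho i) | i < _].
have -> : [tuple asg e (r i) | i < m] = [tuple tnth v (lshift m' i) | i < m].
  by apply: eq_from_tnth => i; rewrite !tnth_mktuple /rho (unsplitK (inl i)).
have -> // : [tuple asg e (r' i) | i < m'] = [tuple tnth v (rshift m i) | i < m'].
by apply: eq_from_tnth => i; rewrite !tnth_mktuple /rho (unsplitK (inr i)).
Qed.

Lemma defpred_not (I : Type) (P : (I -> M) -> Prop) :
  defpred P -> defpred (fun e => ~ P e).
Proof. by move=> dP; apply: defpred_imp dP (defpred_False I). Qed.

Lemma defpred_and (I : Type) (P Q : (I -> M) -> Prop) :
  defpred P -> defpred Q -> defpred (fun e => P e /\ Q e).
Proof.
move=> dP dQ; apply: defpred_ext (defpred_not (defpred_imp dP (defpred_not dQ))) => e.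
by split=> [h|[hP hQ] h]; [apply: contrapT => nh; apply: h => ? ?; apply: nh | exact: h].
Qed.

Lemma defpred_allfin (I : Type) (T : finType) (P : T -> (I -> M) -> Prop) :
  (forall t, defpred (P t)) -> defpred (fun e => forall t, P t e).
Proof.
move=> dP.
have H (s : seq T) : defpred (fun e => forall t, t \in s -> P t e).
  elim: s => [|t s IH].
    by apply: defpred_ext (defpred_not (defpred_False I)) => e; split=> // _ [].
  apply: defpred_ext (defpred_and (dP t) IH) => e; split.
    by move=> [h h'] u; rewrite inE => /orP[/eqP->|/h'].
  by move=> h; split=> [|u us]; apply: h; rewrite inE ?eqxx ?us ?orbT.
apply: defpred_ext (H (enum T)) => e.
by split=> h t => [|_]; apply: h; rewrite mem_enum.
Qed.

Lemma defpred_ex (I : Type) (J : finType) (P : (I + J -> M) -> Prop) :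
  defpred P -> defpred (fun e : I -> M => exists e' : J -> M, P (sumf e e')).
Proof.
move=> [m [phi [rho h]]].
(* Filler for the places of the second block whose variable becomes bound; [r] never points to
   them. *)
have [a0] := carrier_inhabited M.
pose r (i : 'I_m) : 'I_(#|J| + m) :=
  match rho i with inl (inr j) => lshift m (enum_rank j) | _ => rshift #|J| i end.
exists m, (fExn (fren phi r)), (fun i =>
  match rho i with
  | inl (inl i) => inl i | inl (inr j) => inr a0 | inr a => inr a end) => e.
rewrite sat_fExn.
have E (w : #|J|.-tuple M) : sat (fren phi r) [tuple of w ++ [tuple asg e
    (match rho i with
     | inl (inl i) => inl i | inl (inr j) => inr a0 | inr a => inr a end) | i < m]]
    <-> P (sumf e (fun j => tnth w (enum_rank j))).
  rewrite sat_fren h; set a := [tuple _ | _ < _]; set b := [tuple _ | _ < _].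
  suff -> : a = b by [].
  apply: eq_from_tnth => i; rewrite !tnth_mktuple /r.
  by case E : (rho i) => [[i'|j]|c]; rewrite ?tnth_lshift ?tnth_rshift ?tnth_mktuple ?E.
split=> [[e' Pe]|[w /E Pw]]; last by exists (fun j => tnth w (enum_rank j)).
exists [tuple e' (enum_val i) | i < #|J|]; apply/E.
rewrite (_ : (fun j => _) = e') //.
by apply/funext => j; rewrite tnth_mktuple enum_rankK.
Qed.

(** An interpretable sort: a type whose elements are coded by assignments, the
    code of an element being unique up to a definable equivalence. *)
Class isort (X : Type) := Sort {
  ix : finType;
  code : (ix -> M) -> X -> Prop;
  code_fun : forall e x y, code e x -> code e y -> x = y;
  code_tot : forall x, exists e, code e x;
  code_def : defpred (fun e : ix + ix -> M =>
    exists x, code (fun i => e (inl i)) x /\ code (fun i => e (inr i)) x) }.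

Definition dset X {sX : isort X} (D : X -> Prop) :=
  defpred (fun e : ix -> M => exists x, code e x /\ D x).

Lemma dset_ext X {sX : isort X} (D E : X -> Prop) :
  (forall x, D x <-> E x) -> dset D -> dset E.
Proof.
by move=> DE; apply: defpred_ext => e; split=> -[x [cx /DE]]; exists x.
Qed.

Lemma dset_True X {sX : isort X} : dset (fun _ : X => True).
Proof.
apply: defpred_ext (defpred_reindex (fun s : ix + ix => match s with inl i | inr i => i end) code_def).
by move=> e; split=> -[x [cx _]]; exists x.
Qed.

Lemma dset_not X {sX : isort X} (D : X -> Prop) :
  dset D -> dset (fun x => ~ D x).
Proof.
move=> dD; apply: defpred_ext (defpred_and (@dset_True X _) (defpred_not dD)) => e.
split=> [[[x [cx _]] h]|[x [cx nD]]]; first by exists x; split=> // Dx; apply: h; exists x.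
by split=> [|[y [cy Dy]]]; [exists x | apply: nD; rewrite (code_fun cx cy)].
Qed.

Lemma dset_and X {sX : isort X} (D E : X -> Prop) :
  dset D -> dset E -> dset (fun x => D x /\ E x).
Proof.
move=> dD dE; apply: defpred_ext (defpred_and dD dE) => e.
split=> [[[x [cx Dx]] [y [cy Ey]]]|[x [cx [Dx Ex]]]].
  by exists x; do 2!split=> //; rewrite (code_fun cx cy).
by split; exists x.
Qed.

Lemma dset_imp X {sX : isort X} (D E : X -> Prop) :
  dset D -> dset E -> dset (fun x => D x -> E x).
Proof.
move=> dD dE; apply: dset_ext (dset_not (dset_and dD (dset_not dE))) => x.
split=> [h Dx|h [Dx]]; last by apply; apply: h.
by apply: contrapT => nE; apply: h.
Qed.

Lemma dset_or X {sX : isort X} (D E : X -> Prop) :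
  dset D -> dset E -> dset (fun x => D x \/ E x).
Proof.
move=> dD dE; apply: dset_ext (dset_imp (dset_not dD) dE) => x.
split=> [h|[Dx|Ex] //]; have [Dx|nDx] := pselect (D x); by [left | right; apply: h].
Qed.

Lemma dset_allfin X {sX : isort X} (T : finType) (D : T -> X -> Prop) :
  (forall t, dset (D t)) -> dset (fun x => forall t, D t x).
Proof.
move=> dD; apply: defpred_ext (defpred_and (@dset_True X _) (defpred_allfin dD)) => e.
split=> [[[x [cx _]] h]|[x [cx h]]].
  by exists x; split=> // t; have [y [cy]] := h t; rewrite (code_fun cx cy).
by split=> [|t]; exists x.
Qed.

#[global] Instance sort_prod X Y (sX : isort X) (sY : isort Y) : isort (X * Y).
Proof.
refine (@Sort (X * Y)%type (@ix _ sX + @ix _ sY)%type (fun e p =>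
  code (fun i => e (inl i)) p.1 /\ code (fun i => e (inr i)) p.2) _ _ _).
- by move=> e [x y] [x' y'] /= [c1 c2] [/(code_fun c1)-> /(code_fun c2)->].
- move=> [x y]; have [e ex] := code_tot x; have [e' ey] := code_tot y.
  by exists (sumf e e').
- apply: defpred_ext (defpred_and
    (defpred_reindex (fun s : ix + ix => match s with inl i => inl (inl i) | inr i => inr (inl i) end)
      (@code_def X sX))
    (defpred_reindex (fun s : ix + ix => match s with inl i => inl (inr i) | inr i => inr (inr i) end)
      (@code_def Y sY))) => e.
  split=> [[[x [c1 c2]] [y [c3 c4]]]|[[x y] /= [[c1 c2] [c3 c4]]]]; first by exists (x, y).
  by split; [exists x | exists y].
Defined.

#[global] Instance sort_ffun n X (sX : isort X) : isort {ffun 'I_n -> X}.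
Proof.
refine (@Sort {ffun 'I_n -> X} ('I_n * @ix _ sX)%type (fun e f =>
  forall i, code (fun j => e (i, j)) (f i)) _ _ _).
- by move=> e f f' h h'; apply/ffunP => i; apply: code_fun (h i) (h' i).
- move=> f; have [e h] := choice (fun i => code_tot (f i)).
  by exists (fun p => e p.1 p.2).
- have h (i : 'I_n) := defpred_reindex (fun s : ix + ix =>
    match s with inl j => inl (i, j) | inr j => inr (i, j) end) (@code_def X sX).
  apply: defpred_ext (defpred_allfin h) => e; split.
    by move=> /choice[f hf]; exists (finfun f); split=> i; rewrite ffunE; case: (hf i).
  by move=> [f [h1 h2]] i; exists (f i).
Defined.

(** A class is coded by all codes of all its representatives in [D], so no definable choice of
    representatives is required. *)
Definition sort_quot X (sX : isort X) Q (D : X -> Prop) (pi : X -> Q)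
  (dD : dset D) (surj : forall q, exists2 x, D x & pi x = q)
  (dker : dset (fun p : X * X => [/\ D p.1, D p.2 & pi p.1 = pi p.2])) : isort Q.
Proof.
refine (@Sort Q (@ix _ sX) (fun e q => exists2 x, code e x /\ D x & pi x = q) _ _ _).
- by move=> e q q' [x [cx _] <-] [y [cy _] <-]; rewrite (code_fun cx cy).
- by move=> q; have [x Dx <-] := surj q; have [e ex] := code_tot x; exists e, x.
- apply: defpred_ext dker => e; split.
    move=> [[x y] [/= [cx cy] [Dx Dy E]]]; exists (pi x).
    by split; [exists x | exists y].
  move=> [q [[x [cx Dx] E] [y [cy Dy] E']]]; exists (x, y); split=> //=.
  by rewrite E E'.
Defined.

Definition dmap X Y {sX : isort X} {sY : isort Y} (f : X -> Y) :=
  dset (fun p : X * Y => f p.1 = p.2).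

Lemma dset_ex X Y {sX : isort X} {sY : isort Y} (D : X -> Y -> Prop) :
  dset (fun p : X * Y => D p.1 p.2) -> dset (fun x => exists y, D x y).
Proof.
move=> dD; apply: defpred_ext (defpred_ex dD) => e; split.
  by move=> [e' [[x y] /= [[cx cy] Dxy]]]; exists x; split=> //; exists y.
move=> [x [cx [y Dxy]]]; have [e' cy] := code_tot y.
by exists e', (x, y).
Qed.

Lemma dset_all X Y {sX : isort X} {sY : isort Y} (D : X -> Y -> Prop) :
  dset (fun p : X * Y => D p.1 p.2) -> dset (fun x => forall y, D x y).
Proof.
move=> dD; apply: dset_ext (dset_not (dset_ex (D := fun x y => ~ D x y) (dset_not dD))) => x.
split=> [h y|h [y]]; last by apply.
by apply: contrapT => nD; apply: h; exists y.
Qed.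

Lemma dset_pre X Y {sX : isort X} {sY : isort Y} (f : X -> Y) (D : Y -> Prop) :
  dset D -> dmap f -> dset (fun x => D (f x)).
Proof.
move=> dD df.
apply: defpred_ext (defpred_ex (defpred_and df (defpred_reindex (inr : ix -> ix + ix) dD))) => e.
split=> [[e' [[[x y] /= [[cx cy] E]] [y' [cy' Dy']]]]|[x [cx Dx]]].
  by exists x; split=> //; rewrite E (code_fun cy cy').
have [e' cy] := code_tot (f x); exists e'.
by split; [exists (x, f x) | exists (f x)].
Qed.

Lemma dmap_comp X Y Z {sX : isort X} {sY : isort Y} {sZ : isort Z}
    (f : X -> Y) (h : Y -> Z) :
  dmap h -> dmap f -> dmap (fun x => h (f x)).
Proof.
move=> dh df.
apply: defpred_ext (defpred_ex (defpred_and
  (defpred_reindex (fun s : @ix _ sX + @ix _ sY =>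
     match s with inl i => inl (inl i) | inr i => inr i end) df)
  (defpred_reindex (fun s : @ix _ sY + @ix _ sZ =>
     match s with inl i => inr i | inr i => inl (inr i) end) dh))) => e.
split=> [[e' [[[x y] /= [[cx cy] E]] [[y' z] /= [[cy' cz] E']]]]|[[x z] /= [[cx cz] E]]].
  by exists (x, z); split=> //=; rewrite E (code_fun cy cy').
have [e' cy] := code_tot (f x); exists e'.
by split; [exists (x, f x) | exists (f x, z)].
Qed.

Lemma dmap_pair X Y Z {sX : isort X} {sY : isort Y} {sZ : isort Z}
    (f : X -> Y) (h : X -> Z) :
  dmap f -> dmap h -> dmap (fun x => (f x, h x)).
Proof.
move=> df dh.
apply: defpred_ext (defpred_and
  (defpred_reindex (fun s : @ix _ sX + @ix _ sY =>
     match s with inl i => inl i | inr i => inr (inl i) end) df)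
  (defpred_reindex (fun s : @ix _ sX + @ix _ sZ =>
     match s with inl i => inl i | inr i => inr (inr i) end) dh)) => e.
split=> [[[[x y] /= [[cx cy] E]] [[x' z] /= [[cx' cz] E']]]|].
  by exists (x, (y, z)); split=> //=; rewrite -E' -(code_fun cx cx') E.
move=> [[x p] /= [[cx [cy cz]] E]]; rewrite -{}E in cy cz.
by split; [exists (x, f x) | exists (x, h x)].
Qed.

Lemma dmap_id X {sX : isort X} : dmap (fun x : X => x).
Proof.
apply: defpred_ext code_def => e; split=> [[x [c1 c2]]|[[x y] /= [[c1 c2] E]]].
  by exists (x, x).
by exists x; split=> //; rewrite E.
Qed.

Lemma dmap_fst X Y {sX : isort X} {sY : isort Y} : dmap (fun p : X * Y => p.1).
Proof.
apply: defpred_ext (defpred_and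
  (defpred_reindex (fun s : @ix _ sX + @ix _ sX =>
     match s with inl i => inl (inl i) | inr i => inr i end) code_def)
  (defpred_reindex (fun i : @ix _ sY => inl (inr i)) (@dset_True Y _))) => e.
split=> [[[x [c1 c2]] [y [cy _]]]|[[[x y] x'] /= [[[c1 cy] c2] E]]].
  by exists ((x, y), x).
by split; [exists x; rewrite {2}E | exists y].
Qed.

Lemma dmap_snd X Y {sX : isort X} {sY : isort Y} : dmap (fun p : X * Y => p.2).
Proof.
apply: defpred_ext (defpred_and
  (defpred_reindex (fun s : @ix _ sY + @ix _ sY =>
     match s with inl i => inl (inr i) | inr i => inr i end) code_def)
  (defpred_reindex (fun i : @ix _ sX => inl (inl i)) (@dset_True X _))) => e.
split=> [[[y [c1 c2]] [x [cx _]]]|[[[x y] y'] /= [[[cx c1] c2] E]]].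
  by exists ((x, y), y).
by split; [exists y; rewrite {2}E | exists x].
Qed.

Lemma dmap_cst X Y {sX : isort X} {sY : isort Y} (y0 : Y) : dmap (fun _ : X => y0).
Proof.
have [u cu] := code_tot y0.
apply: defpred_ext (defpred_and
  (defpred_subst (fun s : @ix _ sY + @ix _ sY =>
     match s with inl i => inl (inr i) | inr i => inr (u i) end) code_def)
  (defpred_reindex (fun i : @ix _ sX => inl i) (@dset_True X _))) => e.
split=> [[[y [c1 c2]] [x [cx _]]]|[[x y] /= [[cx cy] E]]].
  by exists (x, y); split=> //=; apply: code_fun cu c2.
rewrite -{}E in cy.
by split; [exists y0 | exists x].
Qed.

Lemma dmap_app n X {sX : isort X} (i : 'I_n) : dmap (fun f : {ffun 'I_n -> X} => f i).
Proof.
apply: defpred_ext (defpred_and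
  (defpred_reindex (fun s : @ix _ sX + @ix _ sX =>
     match s with inl j => inl (i, j) | inr j => inr j end) code_def)
  (defpred_reindex inl (@dset_True {ffun 'I_n -> X} _))) => e.
split=> [[[x [c1 c2]] [f [cf _]]]|[[f x] /= [[cf cx] E]]].
  by exists (f, x); split=> //=; apply: code_fun (cf i) c1.
by split; [exists x; split=> //; rewrite -E | exists f].
Qed.

Lemma dmap_finfun n X Y {sX : isort X} {sY : isort Y} (F : 'I_n -> X -> Y) :
  (forall i, dmap (F i)) -> dmap (fun x => [ffun i => F i x]).
Proof.
move=> dF.
have h (i : 'I_n) := defpred_reindex (fun s : @ix _ sX + @ix _ sY =>
     match s with inl j => inl j | inr j => inr (i, j) end) (dF i).
apply: defpred_ext (defpred_and (defpred_reindex inl (@dset_True X _)) (defpred_allfin h)) => e.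
split=> [[[x [cx _]] H]|[[x f] /= [[cx cf] E]]].
  exists (x, [ffun i => F i x]); split=> //=; split=> // i; rewrite ffunE.
  by have [[x' y] /= [[cx' cy] E]] := H i; rewrite (code_fun cx cx') E.
by split=> [|i]; [exists x | exists (x, f i); split=> //=; rewrite -E ffunE].
Qed.

Lemma dset_eq X Y {sX : isort X} {sY : isort Y} (f h : X -> Y) :
  dmap f -> dmap h -> dset (fun x => f x = h x).
Proof.
move=> df dh; have dE : dset (fun p : Y * Y => p.1 = p.2) by exact: dmap_id.
exact: (dset_pre (f := fun x => (f x, h x)) dE (dmap_pair df dh)).
Qed.

Lemma dmap_quot X (sX : isort X) Q (D : X -> Prop) (pi : X -> Q)
  (dD : dset D) (surj : forall q, exists2 x, D x & pi x = q)
  (dker : dset (fun p : X * X => [/\ D p.1, D p.2 & pi p.1 = pi p.2])) :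
  dset (fun p : X * X => D p.2 /\ pi p.1 = pi p.2) ->
  dmap (sY := sort_quot dD surj dker) pi.
Proof.
apply: defpred_ext => e; split=> [[[x y] /= [[cx cy] [Dy E]]]|].
  by exists (x, pi y); split=> //=; split=> //; exists y.
by move=> [[x q] /= [[cx [y [cy Dy] <-]] E]]; exists (x, y).
Qed.

Lemma dset_fin X {sX : isort X} (F : set X) : finite_set F -> dset F.
Proof.
move=> /(@finite_seqP {classic X})[s ->].
elim: s => [|x s IH]; first by apply: dset_ext (dset_not (@dset_True X _)) => x; split.
apply: dset_ext (dset_or (dset_eq (@dmap_id X _) (dmap_cst (x : X))) IH) => y.
rewrite /mkset /= inE; split=> [[->|->]|/orP[/eqP|]]; rewrite ?eqxx ?orbT //; by [left | right].
Qed.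

End Definability.
Arguments code_def {L M X isort}.
Arguments dset_True {L M X sX}.
Arguments dmap_id {L M X sX}.
Arguments dmap_fst {L M X Y sX sY}.
Arguments dmap_snd {L M X Y sX sY}.
Arguments dmap_cst {L M X Y sX sY} y0.
Arguments dmap_app {L M n X sX} i.

(** * Dimension *)

Section Bridge.
Variables (L : language) (M : structure L).

(** The parameters may sit inside any longer tuple [a']: the domain and the equivalence of an
    interpretable set have to share one tuple of parameters. *)
Lemma defpred_formula (I : Type) (P : (I -> M) -> Prop) : defpred P ->
  exists k (a : k.-tuple M), forall k' (r : 'I_k -> 'I_k') (a' : k'.-tuple M),
    (forall i, tnth a' (r i) = tnth a i) -> forall n (h : I -> 'I_n),
    exists phi : formula L (n + k'), forall v : n.-tuple M,
      P (fun j => tnth v (h j)) <-> sat phi [tuple of v ++ a'].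
Proof.
move=> [m [phi [rho H]]]; have [a0] := carrier_inhabited M.
exists m, [tuple match rho i with inl _ => a0 | inr a => a end | i < m].
move=> k' r a' ra n h.
exists (fren phi (fun i => match rho i with
  inl j => lshift k' (h j) | inr _ => rshift n (r i) end)) => v.
rewrite H sat_fren; set b := [tuple _ | _ < _]; set c := [tuple _ | _ < _].
suff -> : b = c by [].
apply: eq_from_tnth => i; rewrite !tnth_mktuple.
by case E : (rho i) => [j|z] /=; rewrite ?tnth_lshift ?tnth_rshift // ra tnth_mktuple E.
Qed.

Lemma defpred_formula2 (I J : Type) (P : (I -> M) -> Prop) (Q : (J -> M) -> Prop)
    n m (h : I -> 'I_n) (h' : J -> 'I_m) : defpred P -> defpred Q ->
  exists k (a : k.-tuple M) (phi : formula L (n + k)) (psi : formula L (m + k)),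
    (forall v : n.-tuple M, P (fun j => tnth v (h j)) <-> sat phi [tuple of v ++ a]) /\
    (forall v : m.-tuple M, Q (fun j => tnth v (h' j)) <-> sat psi [tuple of v ++ a]).
Proof.
move=> /defpred_formula[k [a Ha]] /defpred_formula[k' [a' Ha']].
have [phi Hphi] := Ha _ (@lshift k k') [tuple of a ++ a'] (tnth_lshift a a') n h.
have [psi Hpsi] := Ha' _ (@rshift k k') [tuple of a ++ a'] (tnth_rshift a a') m h'.
by exists (k + k')%N, [tuple of a ++ a'], phi, psi.
Qed.

Definition tcode X {sX : isort M X} (u : #|@ix _ _ _ sX|.-tuple M) (x : X) : Prop :=
  code (fun j => tnth u (enum_rank j)) x.

Definition cls X {sX : isort M X} (x : X) : set (#|@ix _ _ _ sX|.-tuple M) :=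
  [set u | tcode u x].
Arguments cls {X sX} x.

Lemma tcode_tot X {sX : isort M X} (x : X) : exists u, tcode u x.
Proof.
have [e ex] := code_tot x; exists [tuple e (enum_val i) | i < _].
rewrite /tcode (_ : (fun j => _) = e) //; apply/funext => j.
by rewrite tnth_mktuple enum_rankK.
Qed.

Lemma cls_inj X {sX : isort M X} (x y : X) : cls x = cls y -> x = y.
Proof.
have [u ux] := tcode_tot x => E; apply: code_fun (ux) _.
by have : cls y u by rewrite -E.
Qed.

Lemma interpretable_cls X {sX : isort M X} (D : set X) :
  dset D -> interpretable (cls @` D).
Proof.
move=> dD; pose n := #|@ix _ _ _ sX|.
have [k [a [delta [eps [Hd He]]]]] := defpred_formula2 (n := n) (m := n + n) enum_rank
  (fun s => match s with inl i => lshift n (enum_rank i) | inr i => rshift n (enum_rank i) end)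
  dD code_def.
have Ed u : defset delta a u <-> exists x, tcode u x /\ D x by rewrite /defset /= -Hd.
have Ee u v : defrel eps a u v <-> exists x, tcode u x /\ tcode v x.
  rewrite /defrel /defset /= -He /tcode.
  have -> : (fun j => tnth u (enum_rank j)) =
      (fun j => tnth [tuple of u ++ v] (lshift n (enum_rank j))).
    by apply/funext => j; rewrite tnth_lshift.
  have -> // : (fun j => tnth v (enum_rank j)) =
      (fun j => tnth [tuple of u ++ v] (rshift n (enum_rank j))).
  by apply/funext => j; rewrite tnth_rshift.
exists k, delta, eps, a; split.
  split.
  - by move=> u /Ed[x [ux _]]; apply/Ee; exists x.
  - by move=> u v _ _ /Ee[x [ux vx]]; apply/Ee; exists x.
  - move=> u v w _ _ _ /Ee[x [ux vx]] /Ee[y [vy wy]]; apply/Ee; exists x.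
    by rewrite (code_fun vx vy) in ux *.
have C u x : tcode u x -> D x ->
    [set v | defset delta a v /\ defrel eps a u v] = cls x.
  move=> ux Dx; apply/seteqP; split=> v.
    by move=> [_ /Ee[y [uy vy]]]; rewrite /cls /= (code_fun ux uy).
  by move=> vx; split; [apply/Ed | apply/Ee]; exists x.
apply/seteqP; split=> c.
  move=> [x Dx <-]; have [u ux] := tcode_tot x; exists u; last exact: C.
  by apply/Ed; exists x.
by move=> [u /Ed[x [ux Dx]] <-]; exists x => //; rewrite (C u x).
Qed.

Definition cls_fun X Y {sX : isort M X} {sY : isort M Y} (f : X -> Y)
    (c : set (#|@ix _ _ _ sX|.-tuple M)) : set (#|@ix _ _ _ sY|.-tuple M) :=
  [set v | exists x, c = cls x /\ tcode v (f x)].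

Lemma cls_funE X Y {sX : isort M X} {sY : isort M Y} (f : X -> Y) (x : X) :
  cls_fun f (cls x) = cls (f x).
Proof.
apply/seteqP; split=> v; first by move=> [y [E]]; rewrite (cls_inj E).
by move=> vx; exists x.
Qed.

Lemma interpretable_cls_fun X Y {sX : isort M X} {sY : isort M Y} (f : X -> Y)
    (D : set X) (E : set Y) : dset D -> dmap f -> (forall x, D x -> E (f x)) ->
  interpretable_fun (cls @` D) (cls @` E) (cls_fun f).
Proof.
move=> dD df fDE; split.
  by move=> _ [x Dx <-]; exists (f x); [exact: fDE | rewrite cls_funE].
have dG : dset (fun p : X * Y => D p.1 /\ f p.1 = p.2).
  by apply: dset_and => //; apply: dset_pre dD dmap_fst.
have [k [a [phi [_ [Hphi _]]]]] := defpred_formula2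
  (fun s => match s with inl i => lshift _ (enum_rank i) | inr i => rshift _ (enum_rank i) end)
  (fun s => match s with inl i => lshift _ (enum_rank i) | inr i => rshift _ (enum_rank i) end) dG dG.
exists k, phi, a; apply/seteqP; split=> w.
  move=> [_ [u [v [[x Dx <-] ux fv ->]]]]; apply/Hphi.
  exists (x, f x); split=> //=; split.
    move: ux; rewrite /cls /= /tcode; congr code.
    by apply/funext => j; rewrite tnth_lshift.
  move: fv; rewrite cls_funE /cls /= /tcode; congr code.
  by apply/funext => j; rewrite tnth_rshift.
move=> /Hphi[[x y] /= [[cx cy] [Dx E']]].
pose u := [tuple tnth w (lshift #|@ix _ _ _ sY| i) | i < #|@ix _ _ _ sX|].
pose v := [tuple tnth w (rshift #|@ix _ _ _ sX| i) | i < #|@ix _ _ _ sY|].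
exists (cls x), u, v; split.
- by exists x.
- move: cx; rewrite /cls /= /tcode; congr code.
  by apply/funext => j; rewrite tnth_mktuple.
- rewrite cls_funE E'; move: cy; rewrite /cls /= /tcode; congr code.
  by apply/funext => j; rewrite tnth_mktuple.
- apply: eq_from_tnth => i; rewrite -(splitK i).
  by case: (fintype.split i) => j /=; rewrite ?tnth_lshift ?tnth_rshift tnth_mktuple.
Qed.
End Bridge.

Arguments cls {L M X sX} x.

Section Dimension.
Variables (L : language) (T : theory L) (M : structure L).
Variable dim : forall (M : structure L) (n : nat), set (set (n.-tuple M)) -> dimension.
Hypotheses (Hdim : dimension_on T dim) (HM : models T M).

Definition odm X {sX : isort M X} (D : set X) : dimension := dim (cls @` D).

(** The dimension of the empty set is [0] here. *)
Definition setdim X {sX : isort M X} (D : set X) : nat := odflt 0%N (odm D).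
Local Notation dm := setdim.

Lemma odmU X {sX : isort M X} (D E : set X) : dset D -> dset E ->
  odm (D `|` E) = dim_max (odm D) (odm E).
Proof.
move=> dD dE; rewrite /odm image_setU (dim_union Hdim HM) -?image_setU //.
- exact: interpretable_cls.
- exact: interpretable_cls.
- by apply: interpretable_cls; apply: dset_or.
Qed.

Lemma odm0 X {sX : isort M X} : odm (@set0 X) = None.
Proof. by rewrite /odm image_set0 (dim_empty Hdim HM). Qed.

Lemma odm1 X {sX : isort M X} (x : X) : odm [set x] = Some 0%N.
Proof.
apply/(dim_algebraicity Hdim HM).
  by apply: interpretable_cls; apply: dset_fin; apply: finite_set1.
split; first by apply: finite_image; apply: finite_set1.
by exists (cls x); exists x.
Qed.

Lemma dm0 X {sX : isort M X} : dm (@set0 X) = 0%N.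
Proof. by rewrite /setdim odm0. Qed.

Lemma dmU X {sX : isort M X} (D E : set X) : dset D -> dset E ->
  dm (D `|` E) = maxn (dm D) (dm E).
Proof.
move=> dD dE; rewrite /setdim odmU //.
by case: (odm D) (odm E) => [a|] [b|] //=; rewrite ?max0n ?maxn0.
Qed.

(** A nonempty set does not have dimension -oo: it absorbs each of its points, and a point has
    dimension 0. *)
Lemma odm_dm X {sX : isort M X} (D : set X) x : dset D -> D x ->
  odm D = Some (dm D).
Proof.
move=> dD Dx; rewrite /setdim.
have : dim_max (odm D) (odm [set x]) = odm D; last by rewrite odm1; case: (odm D).
rewrite -odmU //; last by apply: dset_fin; apply: finite_set1.
by congr odm; apply/seteqP; split=> y; [move=> [//|->] | left].
Qed.

Lemma dm_le X {sX : isort M X} (D E : set X) : dset D -> dset E ->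
  (forall x, D x -> E x) -> (dm D <= dm E)%N.
Proof.
move=> dD dE DE; rewrite -(_ : dm (D `|` E) = dm E) ?dmU ?leq_maxl //.
by rewrite -dmU //; congr dm; apply/seteqP; split=> x; [move=> [/DE|] | right].
Qed.

Lemma dm_eq0 X {sX : isort M X} (D : set X) : dset D ->
  dm D = 0%N <-> finite_set D.
Proof.
move=> dD; have [[x Dx]|nD] := pselect (exists x, D x); last first.
  have -> : D = set0 by apply/seteqP; split=> x // Dx; apply: nD; exists x.
  by split=> // _; rewrite dm0.
have H := dim_algebraicity Hdim HM (interpretable_cls dD).
have {}H : odm D = Some 0%N <-> finite_set (cls @` D).
  rewrite /odm H; split=> [[]//|fD]; split=> //.
  by exists (cls x); exists x.
split=> [d0|fD]; last first.
  by rewrite /setdim (proj2 H) //; apply: finite_image.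
have := proj1 H; rewrite (odm_dm dD Dx) d0 => /(_ erefl) fD.
have h c : exists y, (cls @` D) c -> cls y = c /\ D y.
  have [[y Dy <-]|nc] := pselect ((cls @` D) c); first by exists y.
  by exists x.
have {h} [k hk] := choice h.
apply: sub_finite_set (finite_image k fD) => y Dy.
exists (cls y); first by exists y.
by have [|E _] := hk (cls y); [exists y | apply: cls_inj].
Qed.

Lemma cls_fiber X Y {sX : isort M X} {sY : isort M Y} (f : X -> Y) (D : set X) (y : Y) :
  cls @` D `&` cls_fun f @^-1` [set cls y] = cls @` [set x | D x /\ f x = y].
Proof.
apply/seteqP; split=> c.
  by move=> [[x Dx <-]]; rewrite /= cls_funE => E; exists x => //; split=> //; exact: cls_inj.
by move=> [x [Dx fx] <-]; split; [exists x | rewrite /= cls_funE fx].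
Qed.

Lemma dm_lower X Y {sX : isort M X} {sY : isort M Y} (f : X -> Y)
    (D : set X) (E : set Y) k : dset D -> dset E -> dmap f ->
  (forall x, D x -> E (f x)) ->
  (forall y, E y -> (dm [set x | D x /\ f x = y] <= k)%N) ->
  (dm D <= dm E + k)%N.
Proof.
move=> dD dE df fDE fib.
have [[x Dx]|nD] := pselect (exists x, D x); last first.
  have -> : D = set0 by apply/seteqP; split=> x // Dx; apply: nD; exists x.
  by rewrite dm0.
have := dim_lower_fibration Hdim HM (interpretable_cls dD) (interpretable_cls dE)
  (interpretable_cls_fun dD df fDE) (k := k).
rewrite -/(odm D) -/(odm E) (odm_dm dD Dx) (odm_dm dE (fDE _ Dx)); apply.
move=> _ [y Ey <-]; rewrite cls_fiber; move: (fib y Ey); rewrite /setdim /odm.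
by case: (dim _).
Qed.

(** Since [setdim] gives the empty set dimension 0, the inequality would fail for empty [D] and [E]
    and positive [k]; hence the point [y0]. *)
Lemma dm_upper X Y {sX : isort M X} {sY : isort M Y} (f : X -> Y)
    (D : set X) (E : set Y) k y0 : dset D -> dset E -> dmap f -> E y0 ->
  (forall x, D x -> E (f x)) ->
  (forall y, E y -> exists2 x, D x & f x = y) ->
  (forall y, E y -> (k <= dm [set x | D x /\ f x = y])%N) ->
  (dm E + k <= dm D)%N.
Proof.
move=> dD dE df Ey0 fDE sur fib.
have := dim_upper_fibration Hdim HM (interpretable_cls dD) (interpretable_cls dE)
  (interpretable_cls_fun dD df fDE) (k := k).
have [x0 Dx0 _] := sur _ Ey0.
rewrite -/(odm D) -/(odm E) (odm_dm dD Dx0) (odm_dm dE Ey0); apply.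
move=> _ [y Ey <-]; rewrite cls_fiber; have [x Dx fx] := sur y Ey.
rewrite -/(odm _) (@odm_dm _ _ _ x) //; first exact: fib.
apply: dset_and => //; apply: dset_eq => //; exact: dmap_cst.
Qed.

Lemma dset_fiber X Y {sX : isort M X} {sY : isort M Y} (f : X -> Y) (D : set X) y :
  dset D -> dmap f -> dset [set x | D x /\ f x = y].
Proof. by move=> dD df; apply: dset_and => //; apply: dset_eq df (dmap_cst _). Qed.

Lemma dm_inj X Y {sX : isort M X} {sY : isort M Y} (f : X -> Y)
    (D : set X) (E : set Y) : dset D -> dset E -> dmap f ->
  (forall x, D x -> E (f x)) ->
  (forall x x', D x -> D x' -> f x = f x' -> x = x') -> (dm D <= dm E)%N.
Proof.
move=> dD dE df fDE inj; rewrite -[dm E]addn0.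
apply: (dm_lower (f := f)) => // y Ey; rewrite leqn0; apply/eqP.
apply/dm_eq0; first exact: dset_fiber.
have [[x [Dx fx]]|nx] := pselect (exists x, D x /\ f x = y).
  apply: (@sub_finite_set _ _ [set x]); last exact: finite_set1.
  by move=> x' [Dx' fx']; apply: inj => //; rewrite fx fx'.
apply: (@sub_finite_set _ _ set0); last exact: finite_set0.
by move=> x' h; apply: nx; exists x'.
Qed.

Lemma dm_surj X Y {sX : isort M X} {sY : isort M Y} (f : X -> Y)
    (D : set X) (E : set Y) : dset D -> dset E -> dmap f ->
  (forall y, E y -> exists2 x, D x & f x = y) -> (dm E <= dm D)%N.
Proof.
move=> dD dE df sur.
have [[y Ey]|nE] := pselect (exists y, E y); last first.
  have -> : E = set0 by apply/seteqP; split=> x // Ex; apply: nE; exists x.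
  by rewrite dm0.
have dD' : dset (fun x => D x /\ E (f x)) by apply: dset_and => //; apply: dset_pre df.
apply: (@leq_trans (dm [set x | D x /\ E (f x)])); last by apply: dm_le => // x [].
rewrite -[dm E]addn0; apply: (dm_upper (f := f) (y0 := y)) => //; first by move=> x [].
by move=> z Ez; have [x Dx fx] := sur z Ez; exists x => //; split=> //; rewrite fx.
Qed.

Lemma dm_prod_ge X Y {sX : isort M X} {sY : isort M Y} (D : set X) (E : set Y) x0 y0 :
  dset D -> dset E -> D x0 -> E y0 ->
  (dm D + dm E <= dm [set p : X * Y | D p.1 /\ E p.2])%N.
Proof.
move=> dD dE Dx0 Ey0.
have dDE : dset (fun p : X * Y => D p.1 /\ E p.2).
  by apply: dset_and; [exact: dset_pre dD dmap_fst | exact: dset_pre dE dmap_snd].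
apply: (dm_upper (f := fst) (y0 := x0)) => //; first exact: dmap_fst.
- by move=> p [].
- by move=> x Dx; exists (x, y0).
- move=> x Dx; apply: (dm_inj (f := fun y => (x, y))) => //.
  + by apply: dset_fiber => //; apply: dmap_fst.
  + by apply: dmap_pair; [exact: dmap_cst | exact: dmap_id].
  + by move=> y y' _ _ [].
Qed.

(** The set of classes is itself an interpretable sort. The projection onto it has fibres of
    dimension at least [k], so Upper Fibration leaves dimension 0 for the quotient, and Algebraicity
    makes it finite. *)
Lemma dm_quot X {sX : isort M X} (D : set X) (E : X -> X -> Prop) k :
  dset D -> dset (fun p : X * X => E p.1 p.2) -> equivalence_on D E ->
  (dm D <= k)%N -> (forall x, D x -> (k <= dm [set y | D y /\ E x y])%N) ->
  exists F : set X, finite_set F /\ forall x, D x -> exists2 y, F y & D y /\ E y x.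
Proof.
move=> dD dE [rE sE tE] Dk kE.
have [[x0 Dx0]|nD] := pselect (exists x, D x); last first.
  by exists set0; split=> // x Dx; case: nD; exists x.
pose c x := [set y | D y /\ E x y].
pose Q := {q : set X | exists2 x, D x & c x = q}.
(* The projection has to be total on the sort: points outside [D] are sent to the class of [x0]. *)
have cP x : exists2 x', D x' & c x' = c (if pselect (D x) then x else x0).
  by case: pselect => Dx; [exists x | exists x0].
pose pi x : Q := exist _ _ (cP x).
have piE x y : D x -> D y -> pi x = pi y <-> E x y.
  move=> Dx Dy; split=> [/(congr1 (@proj1_sig _ _)) /=|Exy].
    case: pselect => //= _; case: pselect => //= _ cxy.
    have : c y y by split=> //; apply: rE.
    by rewrite -cxy => -[].
  apply: eq_exist => /=.
  case: pselect => //= _; case: pselect => //= _; apply/seteqP; split=> z [Dz Ez]; split=> //.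
    by apply: (tE y x z) => //; apply: sE.
  exact: (tE x y z).
have dker : dset (fun p : X * X => [/\ D p.1, D p.2 & pi p.1 = pi p.2]).
  apply: dset_ext (dset_and (dset_pre dD dmap_fst)
    (dset_and (dset_pre dD dmap_snd) dE)) => -[x y] /=.
  by split=> [[Dx [Dy Exy]]|[Dx Dy /piE Exy]]; split=> //; [apply/piE | split=> //; apply: Exy].
have sur q : exists2 x, D x & pi x = q.
  case: q => q [x Dx cx]; exists x => //; apply: eq_exist => /=.
  by case: pselect.
have sur' q : exists x, D x /\ pi x = q by have [x] := sur q; exists x.
pose sQ := sort_quot dD sur dker.
have dpi : dmap (sY := sQ) pi.
  apply: dmap_quot; apply: dset_ext (dset_or (dset_and (dset_pre dD dmap_fst)
    (dset_and (dset_pre dD dmap_snd) dE))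
    (dset_and (dset_not (dset_pre dD dmap_fst)) (dset_and (dset_pre dD dmap_snd)
      (dset_pre dE (dmap_pair (dmap_cst x0) dmap_snd))))) => -[x y] /=.
  have px : ~ D x -> pi x = pi x0.
    by move=> nDx; apply: eq_exist; case: pselect => //; case: pselect.
  split=> [[[Dx [Dy Exy]]|[nDx [Dy Exy]]]|[Dy]].
  - by split=> //; apply/piE.
  - by split=> //; rewrite px //; apply/piE.
  - have [Dx /piE Exy|nDx] := pselect (D x); first by left; split=> //; split=> //; apply: Exy.
    by rewrite px // => /piE Exy; right; split=> //; split=> //; apply: Exy.
have : (dm (sX := sQ) [set: Q] + k <= dm D)%N.
  apply: (dm_upper (f := pi) (y0 := pi x0)) => //; first exact: dset_True.
  move=> q _; have [x Dx <-] := sur q.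
  apply: leq_trans (kE x Dx) _; apply: dm_le.
  - apply: dset_and => //; exact: dset_pre dE (dmap_pair (dmap_cst x) dmap_id).
  - exact: dset_fiber.
  - by move=> y [Dy Exy]; split=> //; apply/piE => //; apply: sE.
move=> /leq_trans/(_ Dk); rewrite -[leqRHS]add0n leq_add2r leqn0 => /eqP.
move=> /(dm_eq0 (@dset_True _ _ _ sQ)) finQ.
have [r rP] := choice sur'.
exists (range r); split; first exact: finite_image.
move=> x Dx; exists (r (pi x)); first by exists (pi x).
by have [Dr /piE Er] := rP (pi x); split=> //; apply: Er.
Qed.
End Dimension.

(** Finite index for sets that are not subgroups or not definable: [S] lies in finitely many
    translates of [H]. *)
Definition fcov (V : zmodType) (H S : set V) :=
  exists F : set V, finite_set F /\ forall x, S x -> exists2 r, F r & H (x - r).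

(** * Definable abelian groups and their dimension *)

Section DefinableGroups.
Variables (L : language) (M : structure L).

Lemma dmap_ext X Y {sX : isort M X} {sY : isort M Y} (f h : X -> Y) :
  f =1 h -> dmap f -> dmap h.
Proof. by move=> fh; apply: dset_ext => p; rewrite fh. Qed.

Definition dzmod (V : zmodType) {sV : isort M V} :=
  dmap (fun p : V * V => p.1 - p.2).
Arguments dzmod V {sV}.

Section Ops.
Variables (V : zmodType) (sV : isort M V) (dV : dzmod V).
Variables (X : Type) (sX : isort M X).

Lemma dmapB (f h : X -> V) : dmap f -> dmap h -> dmap (fun x => f x - h x).
Proof. by move=> df dh; apply: (dmap_comp dV (dmap_pair df dh)). Qed.

Lemma dmapN (f : X -> V) : dmap f -> dmap (fun x => - f x).
Proof.
by move=> df; apply: dmap_ext (dmapB (dmap_cst 0) df) => x; rewrite sub0r.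
Qed.

Lemma dmapD (f h : X -> V) : dmap f -> dmap h -> dmap (fun x => f x + h x).
Proof.
by move=> df dh; apply: dmap_ext (dmapB df (dmapN dh)) => x; rewrite opprK.
Qed.
End Ops.

Lemma dzmod_prod (V W : zmodType) {sV : isort M V} {sW : isort M W} :
  dzmod V -> dzmod W -> dzmod (V * W)%type.
Proof.
move=> dV dW; apply: (@dmap_pair _ _ _ _ _ _ _ _ (fun p : (V * W) * (V * W) => p.1.1 - p.2.1)
  (fun p => p.1.2 - p.2.2)); apply: dmapB => //.
- exact: dmap_comp dmap_fst dmap_fst.
- exact: dmap_comp dmap_fst dmap_snd.
- exact: dmap_comp dmap_snd dmap_fst.
- exact: dmap_comp dmap_snd dmap_snd.
Qed.

Lemma dzmod_ffun n (V : zmodType) {sV : isort M V} :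
  dzmod V -> dzmod {ffun 'I_n -> V}.
Proof.
move=> dV; pose F i (p : {ffun 'I_n -> V} * {ffun 'I_n -> V}) := p.1 i - p.2 i.
have dF i : dmap (F i).
  apply: dmapB => //; first exact: dmap_comp (dmap_app i) dmap_fst.
  exact: dmap_comp (dmap_app i) dmap_snd.
by apply: dmap_ext (dmap_finfun dF) => p; apply/ffunP => i; rewrite !ffunE.
Qed.
End DefinableGroups.
Arguments dzmod {L M} V {sV}.

Section GroupDimension.
Variables (L : language) (T : theory L) (M : structure L).
Variable dim : forall (M : structure L) (n : nat), set (set (n.-tuple M)) -> dimension.
Hypotheses (Hdim : dimension_on T dim) (HM : models T M).
Local Notation dm := (setdim dim).

Lemma dm_fcov (V : zmodType) {sV : isort M V} (H S : set V) : dzmod V ->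
  dset H -> dset S -> fcov H S -> (dm S <= dm H)%N.
Proof.
move=> dV dH dS [F [/(@finite_seqP V)[s ->]]].
elim: s S dS => [|r s IH] S dS cov.
  have -> : S = set0 by apply/seteqP; split=> x // /cov[].
  by rewrite (dm0 Hdim HM).
have dB : dmap (fun x : V => x - r).
  by apply: dmapB => //; [exact: dmap_id | exact: dmap_cst].
have dHr : dset (fun x => H (x - r)) by exact: dset_pre dH dB.
have d1 : dset (fun x => S x /\ H (x - r)) by exact: dset_and.
have d2 : dset (fun x => S x /\ ~ H (x - r)) by apply: dset_and => //; apply: dset_not.
rewrite (_ : S = [set x | S x /\ H (x - r)] `|` [set x | S x /\ ~ H (x - r)]); last first.
  apply/seteqP; split=> x; last by move=> [[]|[]].
  by move=> Sx; have [h|h] := pselect (H (x - r)); [left | right].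
rewrite (dmU Hdim HM) // geq_max; apply/andP; split.
  apply: (dm_inj Hdim HM) (dB) _ _ => //; first by move=> x [].
  by move=> x y _ _ /addIr.
apply: IH => // x [/cov[r' /=]]; rewrite inE => /orP[/eqP->//|r's] h _.
by exists r'.
Qed.

Section Hom.
Variables (V W : zmodType) (sV : isort M V) (sW : isort M W) (dV : dzmod V).
Variables (f : V -> W) (U : set V).
Hypotheses (df : dmap f) (dU : dset U) (sU : additive_subgroup U).
Hypothesis fB : forall x y, U x -> U y -> f (x - y) = f x - f y.

Lemma dset_image : dset [set f x | x in U].
Proof.
apply: dset_ext (dset_ex (D := fun y x => U x /\ f x = y)
  (dset_and (dset_pre dU dmap_snd) (dset_eq (dmap_comp df dmap_snd) dmap_fst))) => y.
by split=> [[x [Ux <-]]|[x Ux <-]]; exists x.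
Qed.

Lemma dset_ker : dset [set x | U x /\ f x = 0].
Proof. exact: dset_fiber. Qed.

(** Over the image all fibres are translates of the kernel, so both fibration axioms apply with the
    same [k]. *)
Lemma dm_hom : dm U = (dm [set f x | x in U] + dm [set x | U x /\ f x = 0%R])%N.
Proof.
have U0 : U 0 by case: sU.
apply/eqP; rewrite eqn_leq; apply/andP; split.
  apply: (dm_lower Hdim HM (f := f)) => //; first exact: dset_image.
    by move=> x Ux; exists x.
  move=> _ [u Uu <-]; apply: (dm_inj Hdim HM (f := fun x => x - u)) => //.
  - exact: dset_fiber.
  - exact: dset_ker.
  - by apply: dmapB => //; [exact: dmap_id | exact: dmap_cst].
  - by move=> x [Ux fx]; split; [exact: sU.2 | rewrite fB // fx subrr].
  - by move=> x y _ _ /addIr.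
apply: (dm_upper Hdim HM (f := f) (y0 := f 0)) => //; first exact: dset_image.
- by exists 0.
- by move=> x Ux; exists x.
move=> _ [u Uu <-]; apply: (dm_inj Hdim HM (f := fun x => u - x)) => //.
- exact: dset_ker.
- exact: dset_fiber.
- by apply: dmapB => //; [exact: dmap_cst | exact: dmap_id].
- by move=> x [Ux fx]; split; [exact: sU.2 | rewrite fB // fx subr0].
- by move=> x y _ _ /addrI/oppr_inj.
Qed.
End Hom.

(** The classes modulo [H] are translates of [H], so each has dimension at least [dm H], which also
    bounds [dm S]; [dm_quot] leaves finitely many of them. *)
Lemma fcov_dm (V : zmodType) {sV : isort M V} (H S : set V) : dzmod V ->
  dset H -> dset S -> additive_subgroup H -> additive_subgroup S ->
  (forall x, H x -> S x) -> (dm S <= dm H)%N -> fcov H S.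
Proof.
move=> dV dH dS sH sS HS dSH.
have [|||x Sx|F [finF FS]] := @dm_quot _ _ _ _ Hdim HM V sV S (fun x y => H (x - y)) (dm H) dS.
- by apply: dset_pre dH _; apply: dmapB => //; [exact: dmap_fst | exact: dmap_snd].
- split=> [x _|x y _ _|x y z _ _ _ h h'].
  + by rewrite subrr; case: sH.
  + by rewrite -opprB => h; rewrite -[_ - _]opprK; apply: additive_subgroupN.
  + by rewrite -(subrKA y) ; apply: additive_subgroupD.
- by [].
- apply: (dm_inj Hdim HM (f := fun h => x - h)) => //.
  + apply: dset_and => //; apply: dset_pre dH _; apply: dmapB => //; last exact: dmap_id.
    exact: dmap_cst.
  + by apply: dmapB => //; [exact: dmap_cst | exact: dmap_id].
  + by move=> h Hh; split; [apply: sS.2 => //; exact: HS | rewrite subKr].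
  + by move=> h h' _ _ /addrI/oppr_inj.
exists F; split=> // x /FS[r Fr [Sr h]]; exists r => //.
by rewrite -opprB; apply: additive_subgroupN.
Qed.
End GroupDimension.

(** * Nilpotent families of operators *)

Lemma subrACA (V : zmodType) (x y z t : V) : (x - y) - (z - t) = (x - z) - (y - t).
Proof. by rewrite !opprB addrACA [RHS]addrACA (addrC (- y)). Qed.

Section Operators.
Variables (S : zmodType) (n c : nat) (t : 'I_n -> S -> S) (S0 : set S).
Hypothesis tB : forall i x y, t i (x - y) = t i x - t i y.
Hypothesis S0_sub : additive_subgroup S0.
Hypothesis tS0 : forall i x, S0 x -> S0 (t i x).

Definition brk (u v : S -> S) (s : S) : S := u (v s) - v (u s).

Definition wop (w : seq 'I_n) (j : 'I_n) : S -> S :=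
  foldr (fun i u => brk (t i) u) (t j) w.

Hypothesis wop_nil : forall w j s, size w = c -> S0 s -> wop w j s = 0.

(** A decreasing filtration of the Lie ring generated by the [t i], playing the role of its lower
    central series: by [lspan_brk] weights add under brackets. The weight of a word exceeds [size w]
    by one, because of the last letter [j]. *)
Inductive lspan : nat -> (S -> S) -> Prop :=
| lspan_word m w j : (m <= (size w).+1)%N -> lspan m (wop w j)
| lspan_sub m u v : lspan m u -> lspan m v -> lspan m (fun s => u s - v s).

Lemma lspan_le m m' u : (m' <= m)%N -> lspan m u -> lspan m' u.
Proof.
move=> le hu; elim: hu le => {m u} [m w j h|m u v _ IH _ IH'] le.
  by apply: lspan_word; apply: leq_trans h.
by apply: lspan_sub; [exact: IH | exact: IH'].
Qed.

Lemma lspanB m u : lspan m u -> forall x y, u (x - y) = u x - u y.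
Proof.
elim=> {m u} [m w j _|m u v _ IH _ IH'] x y; last first.
  by rewrite IH IH' subrACA.
elim: w x y => [|i w IH] x y /=; first exact: tB.
by rewrite /brk IH !tB IH subrACA.
Qed.

Lemma lspan0 m u : lspan m u -> u 0 = 0.
Proof. by move=> hu; have := lspanB hu 0 0; rewrite !subrr. Qed.

Lemma lspanD m u x y : lspan m u -> u (x + y) = u x + u y.
Proof.
move=> hu; rewrite -{1}[y]opprK (lspanB hu); congr (_ + _).
by rewrite -[- y]sub0r (lspanB hu) (lspan0 hu) sub0r opprK.
Qed.

Lemma lspan_closed (B : set S) m u : additive_subgroup B ->
  (forall i x, B x -> B (t i x)) -> lspan m u -> forall s, B s -> B (u s).
Proof.
move=> sB tBB; elim=> {m u} [m w j _|m u v _ IH _ IH'] s Bs; last first.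
  by apply: sB.2; [exact: IH | exact: IH'].
elim: w s Bs => [|i w IH] s Bs /=; first exact: tBB.
by apply: sB.2; [apply/tBB/IH | apply/IH/tBB].
Qed.

Lemma lspan_brk1 i m v : lspan m v -> lspan m.+1 (brk (t i) v).
Proof.
elim=> {m v} [m w j h|m u v _ IH _ IH']; first exact: (@lspan_word _ (i :: w) j).
rewrite (_ : brk _ _ = fun s => brk (t i) u s - brk (t i) v s); first exact: lspan_sub.
by apply/funext => s; rewrite /brk tB subrACA.
Qed.

(** Induction on the first word by the Jacobi identity [[[x, w], v] = [x, [w, v]] - [w, [x, v]]]. *)
Lemma lspan_brk p q u v : lspan p u -> lspan q v -> lspan (p + q) (brk u v).
Proof.
move=> hu; elim: hu q v => {p u} [p w j h|p u u' hu IH hu' IH'] q v hv; last first.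
  rewrite (_ : brk _ _ = fun s => brk u v s - brk u' v s).
    by apply: lspan_sub; [exact: IH | exact: IH'].
  by apply/funext => s; rewrite /brk (lspanB hv) subrACA.
apply: (@lspan_le ((size w).+1 + q)); first by rewrite leq_add2r.
elim: w {h p} q v hv => [|i w IH] q v hv /=; first exact: lspan_brk1.
have hw : lspan 1 (wop w j) by exact: lspan_word.
rewrite (_ : brk _ _ = fun s => brk (t i) (brk (wop w j) v) s - brk (wop w j) (brk (t i) v) s).
  apply: lspan_sub; first exact: lspan_brk1 (IH _ _ hv).
  by rewrite addSnnS; apply/IH/lspan_brk1.
apply/funext => s; rewrite /brk tB (lspanB hw) !(lspanB hv) !opprB !addrA.
by rewrite [RHS](ACl (1*8*3*6*(5*2)*(7*4))) /= !subrr !addr0.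
Qed.

Lemma lspan_nil m u s : (c < m)%N -> lspan m u -> S0 s -> u s = 0.
Proof.
move=> cm hu S0s; elim: hu cm => {m u} [m w j h|m u v _ IH _ IH'] cm; last first.
  by rewrite IH // IH' // subrr.
have {h cm} : (c <= size w)%N by rewrite -ltnS; apply: leq_trans h.
elim: w s S0s => [|i w IH] s S0s; first by rewrite leqn0 => /eqP c0; apply: wop_nil.
rewrite leq_eqVlt => /orP[/eqP h|]; first exact: wop_nil.
rewrite ltnS => h /=; rewrite /brk !IH //; last exact: tS0.
by have := tB i 0 0; rewrite !subrr => ->; rewrite subrr.
Qed.

Lemma iter_lspanB N m u x y : lspan m u -> iter N u (x - y) = iter N u x - iter N u y.
Proof. by move=> hu; elim: N => //= N ->; rewrite (lspanB hu). Qed.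

Lemma iter_lspan0 N m u : lspan m u -> iter N u 0 = 0.
Proof. by move=> hu; elim: N => //= N ->; rewrite (lspan0 hu). Qed.

Lemma iter_lspanD N m u x y : lspan m u -> iter N u (x + y) = iter N u x + iter N u y.
Proof. by move=> hu; elim: N => //= N ->; rewrite (lspanD _ _ hu). Qed.

(* [ad u] is nilpotent on the span, so that [v] maps the kernel of [u ^ N] into
   that of [u ^ (N + c)]. *)
Lemma iter_lspan_comm u N m q v s : lspan 1 u -> lspan q v -> (c < q + m)%N ->
  S0 s -> iter N u s = 0 -> iter (N + m) u (v s) = 0.
Proof.
move=> hu; elim: N m q v s => [|N IHN] m q v s.
  by move=> hv _ _ /= ->; rewrite (lspan0 hv) (iter_lspan0 _ hu).
elim: m q v s => [|m IHm] q v s hv lt S0s us.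
  by rewrite (lspan_nil _ hv S0s) ?(iter_lspan0 _ hu) // -(addn0 q).
have S0us : S0 (u s) by exact: lspan_closed S0_sub tS0 hu _ S0s.
(* In [v (u s)] one power of [u] has been spent on [s]; in [brk u v s] the weight of the operator
   has risen. The two inductions take one term each. *)
rewrite addnS iterSr (_ : u (v s) = v (u s) + brk u v s); last by rewrite /brk addrC subrK.
rewrite (iter_lspanD _ _ _ hu) {1}addSnnS (IHN m.+1 q v (u s)) ?add0r //; last by rewrite -iterSr.
by apply: (IHm (1 + q)%N) => //; [exact: lspan_brk | rewrite add1n addSnnS].
Qed.

(** * An Engel theorem for families nilpotent together with their brackets *)

Section Engel.
Variable A : set S.
Hypothesis A_sub : additive_subgroup A.
Hypothesis tA : forall i x, A x -> A (t i x).
Hypothesis AS0 : forall x, A x -> S0 x.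
Hypothesis A_inj : forall a, A a -> (forall i, t i a = 0) -> a = 0.

Let locnil a := A a /\ forall w j, exists N, iter N (wop w j) a = 0.

Let locnil_lspan u a : lspan 1 u -> locnil a -> locnil (u a).
Proof.
move=> hu [Aa ha]; split; first exact: lspan_closed hu _ Aa.
move=> w j; have [N hN] := ha w j; exists (N + c)%N.
by apply: (@iter_lspan_comm _ _ _ 1%N) => //; [exact: lspan_word | exact: AS0].
Qed.

Let kills l a := forall w j, (l <= size w)%N -> wop w j a = 0.

Let kills_lspan l m u a : kills l a -> (l < m)%N -> lspan m u -> u a = 0.
Proof.
move=> ka lm hu; elim: hu lm => {m u} [m w j h|m u v _ IH _ IH'] lm.
  by apply: ka; rewrite -ltnS; apply: leq_trans h.
by rewrite IH // IH' // subrr.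
Qed.

(** The words of [ws] are treated one after the other: [u] is applied to [b] as long as the result
    is nonzero, and the last nonzero vector is killed by [u]. Words treated before still kill it, as
    their brackets with [u] have weight beyond [l.+1] and vanish there. *)
Let kills_step l (ws : seq (seq 'I_n * 'I_n)) a :
  (forall p, p \in ws -> size p.1 = l) -> a != 0 -> locnil a -> kills l.+1 a ->
  exists b, [/\ b != 0, locnil b, kills l.+1 b & forall p, p \in ws -> wop p.1 p.2 b = 0].
Proof.
elim: ws => [|p ws IH] sz a0 na ka; first by exists a.
have [q qws|{a0 na ka} b [b0 nb kb hb]] := IH _ a0 na ka.
  by apply: sz; rewrite inE qws orbT.
have sp : size p.1 = l by apply: sz; rewrite inE eqxx.
have hu : lspan l.+1 (wop p.1 p.2) by apply: lspan_word; rewrite sp.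
have hu1 : lspan 1 (wop p.1 p.2) by exact: lspan_word.
set u := wop p.1 p.2 in hu hu1 *.
have exN : exists N, iter N u b == 0 by case: nb => _ /(_ p.1 p.2)[N /eqP]; exists N.
case: (ex_minnP exN) => -[|N] /eqP hN minN; first by case/eqP: b0; exact: hN.
exists (iter N u b).
have hcomm m v x : lspan m v -> (0 < m)%N -> kills l.+1 x -> v x = 0 -> v (u x) = 0.
  move=> hv m0 kx vx; have := kills_lspan kx _ (lspan_brk hu hv).
  rewrite /brk vx (lspan0 hu) sub0r => h; apply/eqP; rewrite -oppr_eq0; apply/eqP.
  by apply: h; rewrite -[ltnLHS]addn0 ltn_add2l.
have hlocal k : [/\ locnil (iter k u b), kills l.+1 (iter k u b) &
    forall p, p \in ws -> wop p.1 p.2 (iter k u b) = 0].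
  elim: k => [|k [nk kk hk]] //=; split; first exact: locnil_lspan.
    by move=> w j lw; apply: (hcomm 1%N) => //; [exact: lspan_word | exact: kk].
  by move=> q qws; apply: (hcomm 1%N) => //; [exact: lspan_word | exact: hk].
have [nk kk hk] := hlocal N.
split=> //; first by apply/eqP => /eqP /minN; rewrite ltnn.
by move=> q; rewrite inE => /orP[/eqP->|/hk].
Qed.

(* Nilpotency of the [t i] alone would not suffice: in characteristic [p], [X] and
   [d/dX] are nilpotent on polynomials modulo [X ^ p], without common kernel. *)
Lemma engel a : A a -> (forall w j, exists N, iter N (wop w j) a = 0) -> a = 0.
Proof.
move=> Aa ha; apply: contrapT => /eqP a0.
(* Downward induction on the length from which all words kill some nonzero vector; at length 0 the
   [t i] themselves kill it. *)
have H k : (k <= c)%N -> exists b, [/\ b != 0, locnil b & kills (c - k) b].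
  elim: k => [|k IH] kc.
    exists a; split=> // w j; rewrite subn0 => cw.
    by apply: (@lspan_nil c.+1) => //; [exact: lspan_word | exact: AS0].
  have [b [b0 nb kb]] := IH (ltnW kc).
  pose ws := [seq (val p.1, p.2) | p <- enum {: (c - k.+1).-tuple 'I_n * 'I_n}].
  have [||d [d0 nd kd hd]] := @kills_step (c - k.+1) ws b _ b0 nb.
  - by move=> _ /mapP[p _ ->]; rewrite size_tuple.
  - by rewrite subnSK.
  exists d; split=> // w j; rewrite leq_eqVlt => /orP[/eqP sw|/kd//].
  apply: (hd (w, j)); apply/mapP.
  have sw' : size w == (c - k.+1)%N by rewrite sw.
  by exists (Tuple sw', j); rewrite ?mem_enum.
have [b [b0 [Ab _]]] := H c (leqnn c).
rewrite subnn => kb; move/eqP: b0; apply; apply: A_inj => // i.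
exact: (kb [::] i).
Qed.
End Engel.
End Operators.

(** Stand-in for a chain condition: the subgroups to which it is applied may grow forever, but their
    dimensions stabilise. *)
Lemma bounded_stable (h : nat -> nat) B N1 :
  (forall N, (h N <= h N.+1)%N) -> (forall N, (h N <= B)%N) ->
  exists2 N0, (N1 <= N0)%N & forall N, (N0 <= N)%N -> h N = h N0.
Proof.
move=> hS hB; have hm N N' : (N <= N')%N -> (h N <= h N')%N.
  by move=> /subnK<-; elim: (N' - N)%N => //= k /leq_trans; apply.
move: {2}(B - h N1)%N (leqnn (B - h N1)) => k; elim: k N1 => [|k IH] N1 hk.
  exists N1 => // N le; apply/eqP; rewrite eqn_leq [X in _ && X]hm // andbT.
  by apply: leq_trans (hB N) _; rewrite -subn_eq0 -leqn0.
have [st|/existsNP[N /not_implyP[le /eqP ne]]] := pselect (forall N, (N1 <= N)%N -> h N = h N1).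
  by exists N1.
have lt : (h N1 < h N)%N by rewrite ltn_neqAle eq_sym ne hm.
have [|N0 le0 st] := IH N; last by exists N0 => //; apply: leq_trans le0.
rewrite -ltnS; apply: leq_trans hk; rewrite ltn_sub2l //.
exact: leq_trans lt (hB N).
Qed.

(** * The Fitting decomposition up to finite index *)

Section Fitting.
Variables (L : language) (T : theory L) (M : structure L).
Variable dim : forall (M : structure L) (n : nat), set (set (n.-tuple M)) -> dimension.
Hypotheses (Hdim : dimension_on T dim) (HM : models T M).
Local Notation dm := (setdim dim).
Variables (S : zmodType) (sS : isort M S) (dS : dzmod S).

Lemma dmap_iter (u : S -> S) N : dmap u -> dmap (iter N u).
Proof.
move=> du; elim: N => [|N IH] /=; first exact: dmap_id.
exact: dmap_comp du IH.
Qed.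

Section Step.
Variables (S0 A : set S) (c : nat) (u : S -> S) (U : nat -> set S).
Hypothesis A_sub : additive_subgroup A.
Hypotheses (du : dmap u) (uB : forall x y, u (x - y) = u x - u y).
Hypotheses (dU : forall N, dset (U N)) (U_sub : forall N, additive_subgroup (U N)).
Hypotheses (US : forall N x, U N x -> U N.+1 x).
Hypotheses (uU : forall N x, U N x -> U (N + c)%N (u x)).
Hypotheses (uA : forall x, A x -> A (u x)) (ucA : forall N x, U N x -> A (iter c u x)).

(* With [K = ker u ^ m] and [I = u ^ m (U N0)] for large [m] and [N0], the
   dimensions of [K] and [I] add up to that of [U N0] and [K] meets [I] in a finite
   set, so [K + I] has finite index in a larger [U N]; moreover [I] lies in [A]. *)
Lemma fitting_step N1 : fcov [set s | exists2 a, A a & U N1 (s - a)] S0 ->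
  exists N, fcov [set s | exists2 a, A a & U N (s - a) /\ iter N u (s - a) = 0] S0.
Proof.
move=> [F [finF FS0]].
have Um N N' x : (N <= N')%N -> U N x -> U N' x.
  by move=> /subnK<-; elim: (N' - N)%N => //= k IH /IH; rewrite addSn; apply: US.
have iuB k x y : iter k u (x - y) = iter k u x - iter k u y.
  by elim: k => //= k ->; rewrite uB.
have iu0 k : iter k u 0 = 0 by have := iuB k 0 0; rewrite !subrr.
have uU' k N x : U N x -> U (N + k * c)%N (iter k u x).
  move=> Ux; elim: k => [|k IH] /=; first by rewrite addn0.
  by rewrite mulSn addnCA addnC; apply: uU.
have [N0 le10 st] := @bounded_stable (fun N => dm (U N)) (dm [set: S]) N1
  (fun N => dm_le Hdim HM (dU N) (dU N.+1) (@US N))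
  (fun N => dm_le Hdim HM (dU N) dset_True (fun _ _ => I)).
pose K m := [set s | U N0 s /\ iter m u s = 0].
have dK m : dset (K m) by apply: dset_fiber => //; exact: dmap_iter.
have K_sub m : additive_subgroup (K m).
  split; first by split; [case: (U_sub N0) | exact: iu0].
  by move=> x y [Ux ux] [Uy uy]; split; [apply: (U_sub N0).2 | rewrite iuB ux uy subrr].
have KS m x : K m x -> K m.+1 x by move=> [Ux ux]; split=> //=; rewrite ux; exact: (iu0 1%N).
(* The search starts at [c] because [iter c u] maps [U N0] into [A]. *)
have [m lem stK] := @bounded_stable (fun m => dm (K m)) (dm [set: S]) c
  (fun m => dm_le Hdim HM (dK m) (dK m.+1) (@KS m))
  (fun m => dm_le Hdim HM (dK m) dset_True (fun _ _ => I)).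
have di : dmap (iter m u) by exact: dmap_iter.
pose I := [set iter m u x | x in U N0].
have dI : dset I by exact: dset_image.
have I_sub : additive_subgroup I.
  split; first by exists 0; [case: (U_sub N0) | exact: iu0].
  move=> _ _ [x Ux <-] [y Uy <-]; exists (x - y); last exact: iuB.
  exact: (U_sub N0).2.
(* The intersection lies in the image of [K (m + m)] under [iter m u]. The kernel of this map on
   [K (m + m)] contains [K m], which already has the dimension of [K (m + m)]. *)
have KI0 : dm [set x | K m x /\ I x] = 0%N.
  have dKI : dset (fun x => K m x /\ I x) by exact: dset_and.
  have := dm_hom Hdim HM dS di (dK (m + m)%N) (K_sub _) (fun x y _ _ => iuB m x y).
  rewrite (stK (m + m)%N) ?leq_addr // => e.
  apply/eqP; rewrite -leqn0.
  apply: (@leq_trans (dm [set iter m u x | x in K (m + m)%N])).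
    apply: (dm_le Hdim HM) => //; first exact: dset_image.
    by move=> y [[_ h] [x Ux ux]]; exists x => //; split=> //; rewrite iterD ux.
  rewrite -(leq_add2r (dm (K m))) add0n {2}e leq_add2l.
  apply: (dm_le Hdim HM) => //; first exact: dset_fiber.
  by move=> x [Ux ux]; do 2!split=> //; rewrite iterD ux iu0.
(* Each application of [u] costs [c] in the index of [U], so this is where [iter m u] sends
   [U N0]. *)
set N2 := (N0 + m * c)%N.
have le02 : (N0 <= N2)%N by rewrite leq_addr.
pose P := [set p : S * S | K m p.1 /\ I p.2].
have dP : dset P by apply: dset_and; [exact: dset_pre dmap_fst | exact: dset_pre dmap_snd].
have P_sub : additive_subgroup P.
  split; first by split; [case: (K_sub m) | case: I_sub].
  by move=> x y [? ?] [? ?]; split; [apply: (K_sub m).2 | apply: I_sub.2].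
have dD : dmap (fun p : S * S => p.1 + p.2) by apply: dmapD => //; [exact: dmap_fst | exact: dmap_snd].
have DB (x y : S * S) : P x -> P y -> (x - y).1 + (x - y).2 = (x.1 + x.2) - (y.1 + y.2).
  by move=> _ _ /=; rewrite opprD addrACA.
pose KI := [set p.1 + p.2 | p in P].
have dKI : dset KI by exact: dset_image.
have KI_sub : additive_subgroup KI.
  split; first by exists 0; [case: P_sub | rewrite addr0].
  move=> _ _ [x Px <-] [y Py <-]; exists (x - y); last by rewrite DB.
  exact: P_sub.2.
have IA x : I x -> A x.
  move=> [y Uy <-]; rewrite -(subnK lem) iterD.
  have := ucA Uy; move: (iter c u y) => z Az.
  by elim: (m - c)%N => //= k; apply: uA.
have covKI : fcov KI (U N2).
  apply: (fcov_dm Hdim HM) => //.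
    move=> _ [[x y] [[Ux ux] [z Uz <-]] <-].
    apply: additive_subgroupD; [exact: U_sub | exact: Um Ux | exact: uU'].
  rewrite (st _ le02).
  have kerP : dm [set p | P p /\ p.1 + p.2 = 0%R] = 0%N.
    apply/eqP; rewrite -leqn0 -KI0; apply: (dm_inj Hdim HM (f := fst)).
    - exact: dset_fiber.
    - exact: dset_and.
    - exact: dmap_fst.
    - move=> p [[Kp Ip] e]; split=> //.
      have -> : p.1 = - p.2 by apply/eqP; rewrite -addr_eq0 e.
      exact: additive_subgroupN.
    - move=> [x y] [x' y'] [_ /= e] [_ /= e'] ex.
      by move: e'; rewrite -ex -e => /addrI ->.
  rewrite (dm_hom Hdim HM dS di (dU N0) (U_sub N0) (fun x y _ _ => iuB m x y)) addnC.
  have := dm_prod_ge Hdim HM (dK m) dI (proj1 (K_sub m)) (proj1 I_sub).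
  rewrite -/P (dm_hom Hdim HM (dzmod_prod dS dS) dD dP P_sub DB) kerP addn0.
  by [].
have [F' [finF' F'V]] := covKI.
(* One number has to serve both as the index of [U] and as the exponent of [u]. *)
exists (maxn N2 m), [set x + y | x in F & y in F']; split; first exact: finite_image2.
move=> s /FS0[r Fr [a Aa Ura]].
have /F'V[r' Fr' [[x y] [[Ux ux] Iy] /= e]] := Um _ _ _ (leq_trans le10 le02) Ura.
exists (r + r'); first by exists r => //; exists r'.
exists (a + y); first by apply: additive_subgroupD => //; exact: IA.
have -> : s - (r + r') - (a + y) = x.
  rewrite -(addrK y x) e !opprD !addrA; congr (_ - _).
  by rewrite [LHS](ACl (1*2*4*3)).
split; first by apply: Um Ux; rewrite leq_max le02.
by rewrite -(subnK (leq_maxr N2 m)) iterD ux iu0.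
Qed.
End Step.

Section Decomposition.
Variables (S0 A : set S) (n c : nat) (t : 'I_n -> S -> S).
Hypotheses (dS0 : dset S0) (S0_sub : additive_subgroup S0).
Hypotheses (A_sub : additive_subgroup A) (AS0 : forall x, A x -> S0 x).
Hypotheses (dt : forall i, dmap (t i)) (tB : forall i x y, t i (x - y) = t i x - t i y).
Hypotheses (tS0 : forall i x, S0 x -> S0 (t i x)) (tA : forall i x, A x -> A (t i x)).
Hypothesis wop_nil : forall w j s, size w = c -> S0 s -> wop t w j s = 0.
Hypothesis wop_A : forall w j s, S0 s -> A (iter c (wop t w j) s).
Hypothesis A_inj : forall a, A a -> (forall i, t i a = 0) -> a = 0.

Lemma dmap_wop w j : dmap (wop t w j).
Proof.
elim: w => [|i w IH] /=; first exact: dt.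
by apply: dmapB => //; [exact: dmap_comp (dt i) IH | exact: dmap_comp IH (dt i)].
Qed.

Let U (ws : seq (seq 'I_n * 'I_n)) N :=
  [set s | S0 s /\ forall p, p \in ws -> iter N (wop t p.1 p.2) s = 0].

Let word_span w j : lspan t 1 (wop t w j). Proof. exact: lspan_word. Qed.

Let dU ws N : dset (U ws N).
Proof.
elim: ws => [|p ws IH].
  by apply: dset_ext dS0 => s; split=> [|[]].
have d1 : dset (fun s => iter N (wop t p.1 p.2) s = 0).
  by apply: dset_eq; [apply/dmap_iter/dmap_wop | exact: dmap_cst].
apply: dset_ext (dset_and IH d1) => s; split=> [[[S0s h] h']|[S0s h]].
  by split=> // q; rewrite inE => /orP[/eqP->|/h].
by split; [split=> // q qws|]; apply: h; rewrite inE ?eqxx ?qws ?orbT.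
Qed.

Let U_sub ws N : additive_subgroup (U ws N).
Proof.
split; first by split=> [|p _]; [case: S0_sub | apply: (iter_lspan0 tB)].
move=> x y [Sx hx] [Sy hy]; split=> [|p pws]; first exact: S0_sub.2.
by rewrite (iter_lspanB tB _ _ _ (word_span _ _)) hx // hy // subrr.
Qed.

Let U_lspan ws N v s : lspan t 1 v -> U ws N s -> U ws (N + c)%N (v s).
Proof.
move=> hv [Ss hs]; split=> [|p pws]; first exact: lspan_closed hv _ Ss.
by apply: (iter_lspan_comm tB S0_sub tS0 wop_nil (word_span _ _) hv) => //; exact: hs.
Qed.

Let fitting_words ws : exists N, fcov [set s | exists2 a, A a & U ws N (s - a)] S0.
Proof.
elim: ws => [|p ws [N covN]].
  exists 0%N, [set 0]; split; first exact: finite_set1.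
  move=> s Ss; exists 0 => //; exists 0; first by case: A_sub.
  by rewrite !subr0; split.
have hp := word_span p.1 p.2.
have [|||||N' [F [finF FS0]]] := @fitting_step S0 A c (wop t p.1 p.2) (U ws) A_sub
  (dmap_wop _ _) _ (dU ws) (U_sub ws) _ _ _ _ N covN.
- exact: lspanB hp.
- by move=> k x [Sx hx]; split=> // q /hx /= ->; rewrite (lspan0 tB (word_span _ _)).
- by move=> k x; apply: U_lspan.
- by move=> x; apply: lspan_closed hp _.
- by move=> k x [Sx _]; apply: wop_A.
exists N', F; split=> // s /FS0[r Fr [a Aa [[Ss h] h']]]; exists r => //; exists a => //.
by split=> // q; rewrite inE => /orP[/eqP->|/h].
Qed.

(** Words of length at least [c] vanish on [S0], so finitely many applications of [fitting_step]
    make all words nilpotent on [u]. The [t i] preserve this property, and [engel] kills every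
    vector of [A] that has it. *)
Lemma fitting : exists F : set S, finite_set F /\ forall s, S0 s ->
  exists r a u, [/\ F r, A a, S0 u, s = r + (a + u) &
    forall w, A (foldr t u w) -> foldr t u w = 0].
Proof.
pose ws := flatten [seq [seq (val p.1, p.2) | p <- enum {: l.-tuple 'I_n * 'I_n}] | l <- iota 0 c].
have wsP w j : (size w < c)%N -> (w, j) \in ws.
  move=> h; apply/flattenP; exists [seq (val p.1, p.2) | p <- enum {: (size w).-tuple 'I_n * 'I_n}].
    by apply/mapP; exists (size w); rewrite ?mem_iota.
  by apply/mapP; exists (in_tuple w, j); rewrite ?mem_enum.
have [N [F [finF FS0]]] := fitting_words ws.
exists F; split=> // s /FS0[r Fr [a Aa Uu]].
exists r, a, (s - r - a); split=> //; first by case: Uu.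
  by rewrite [a + _]addrC subrK addrC subrK.
move: (s - r - a) Uu => u Uu w.
have {Uu} : exists N, U ws N (foldr t u w).
  elim: w => [|i w [k Uk]]; first by exists N.
  by exists (k + c)%N; apply: U_lspan => //; apply: (word_span [::]).
move=> [k [Sw hw]] Aw; apply: (engel tB S0_sub tS0 wop_nil A_sub tA AS0 A_inj Aw) => v j.
have [vc|cv] := ltnP (size v) c; first by exists k; apply: (hw (v, j)); apply: wsP.
exists 1%N; apply: (lspan_nil tB tS0 wop_nil (m := c.+1)) => //; exact: lspan_word.
Qed.
End Decomposition.
End Fitting.

(** * The semidirect product and its Cartan families *)

Lemma pair_ext (X Y : Type) (s t : X * Y) : s.1 = t.1 -> s.2 = t.2 -> s = t.
Proof. by case: s t => [? ?] [? ?] /= -> ->. Qed.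

Section FiniteIndex.
Variable V : zmodType.
Implicit Types H : set V.

Lemma finite_index_fcov H : H 0 -> finite_index H -> fcov H setT.
Proof.
move=> H0 fH.
have h (c : set V) : exists r, (exists x, [set x + h | h in H] = c) -> [set r + h | h in H] = c.
  have [[x xc]|nx] := pselect (exists x, [set x + h | h in H] = c); first by exists x.
  by exists 0.
have [r rP] := choice h.
exists (r @` cosets H setT); split; first exact: finite_image.
move=> x _; exists (r [set x + h | h in H]); first by exists [set x + h | h in H] => //; exists x.
set c := [set x + h | h in H].
have [y Hy e] : [set r c + h | h in H] x.
  by rewrite (rP c); [exists 0; rewrite ?addr0 | exists x].
by rewrite -[X in X - _]e addrC addKr.
Qed.

Lemma finite_index_pre (W : zmodType) (f : V -> W) (H : set W) :
  (forall x y, f (x - y) = f x - f y) -> additive_subgroup H ->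
  finite_index H -> finite_index [set x | H (f x)].
Proof.
move=> fB sH fH; apply: sub_finite_set (finite_image (preimage f) fH).
move=> _ [x _ <-]; exists [set f x + h | h in H]; first by exists (f x).
apply/seteqP; split=> y.
  move=> [h Hh e]; exists (y - x); last by rewrite addrC subrK.
  by rewrite /= fB -e addrC addKr.
by move=> [z Hz <-]; exists (f z) => //; rewrite -{1}(addrK z x) fB subrK.
Qed.

Lemma additive_subgroup_all I (H : I -> set V) :
  (forall i, additive_subgroup (H i)) -> additive_subgroup [set x | forall i, H i x].
Proof.
move=> sH; split=> [i|x y Hx Hy i]; first by case: (sH i).
by apply: (sH i).2.
Qed.

Lemma finite_index_all n (H : 'I_n -> set V) :
  (forall i, finite_index (H i)) -> finite_index [set x | forall i, H i x].
Proof.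
move=> fH.
have fHs (s : seq 'I_n) : finite_index [set x | forall i, i \in s -> H i x].
  elim: s => [|i s IH].
    rewrite (_ : [set x | _] = setT); first exact: finite_indexT.
    by apply/seteqP; split.
  rewrite (_ : [set x | _] = H i `&` [set x | forall i, i \in s -> H i x]).
    exact: finite_indexI.
  apply/seteqP; split=> x.
    by move=> h; split=> [|j js]; apply: h; rewrite inE ?eqxx ?js ?orbT.
  by move=> [h h'] j; rewrite inE => /orP[/eqP->|/h'].
rewrite (_ : [set x | _] = [set x | forall i, i \in enum 'I_n -> H i x]) //.
by apply/seteqP; split=> x h i; [move=> _|]; apply: h; rewrite ?mem_enum.
Qed.
End FiniteIndex.

Section LieTheory.
Variables (g : lieRingType) (A : lieModType g).
Implicit Types (x y z : g) (a b : A).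

Lemma lie0r x : lie x 0 = 0.
Proof. by apply: (addrI (lie x 0)); rewrite -lieDr !addr0. Qed.

Lemma lie0l x : lie 0 x = 0.
Proof. by rewrite lie_antisym lie0r oppr0. Qed.

Lemma lieNr x y : lie x (- y) = - lie x y.
Proof. by apply/eqP; rewrite -addr_eq0 -lieDr addNr lie0r. Qed.

Lemma lieBr x y z : lie x (y - z) = lie x y - lie x z.
Proof. by rewrite lieDr lieNr. Qed.

Lemma lie_derivation x y z : lie x (lie y z) = lie (lie x y) z + lie y (lie x z).
Proof.
have := lie_jacobi x y z.
rewrite (lie_antisym (lie x y) z) (lie_antisym x z) lieNr => /eqP.
by rewrite -addrA addr_eq0 opprD addrC => /eqP.
Qed.

Lemma act0r x : act x (0 : A) = 0.
Proof. by apply: (addrI (act x 0)); rewrite -actDr !addr0. Qed.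

Lemma act0l a : act (0 : g) a = 0.
Proof. by apply: (addrI (act 0 a)); rewrite -actDl !addr0. Qed.

Lemma actNr x a : act x (- a) = - act x a.
Proof. by apply/eqP; rewrite -addr_eq0 -actDr addNr act0r. Qed.

Lemma actNl x a : act (- x) a = - act x a.
Proof. by apply/eqP; rewrite -addr_eq0 -actDl addNr act0l. Qed.

Lemma actBr x a b : act x (a - b) = act x a - act x b.
Proof. by rewrite actDr actNr. Qed.

Lemma actBl x y a : act (x - y) a = act x a - act y a.
Proof. by rewrite actDl actNl. Qed.

(** The bracket of the semidirect product of [g] and [A]; a map [g -> A] is a
    derivation when its graph is closed under it. *)
Definition sbr (s t : g * A) : g * A :=
  (lie s.1 t.1, act s.1 t.2 - act t.1 s.2).

Lemma sbr0r s : sbr s 0 = 0.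
Proof. by rewrite /sbr /= lie0r act0r act0l subrr. Qed.

Lemma sbr0l s : sbr 0 s = 0.
Proof. by rewrite /sbr /= lie0l act0r act0l subrr. Qed.

Lemma sbrBr s t u : sbr s (t - u) = sbr s t - sbr s u.
Proof.
rewrite /sbr /= lieBr actBr actBl subrACA.
by rewrite [in RHS]/GRing.add /=.
Qed.

Lemma sbr_derivation s t u : sbr s (sbr t u) = sbr (sbr s t) u + sbr t (sbr s u).
Proof.
apply: pair_ext => /=; first exact: lie_derivation.
rewrite !act_lie !actBr !opprB !addrA.
by rewrite [RHS](ACl (1*8*3*6*(7*4)*(5*2))) /= !subrr !addr0.
Qed.

Section Words.
Variables (n c : nat).
Hypothesis g_nil : forall (w : seq g) y, size w = c -> foldr (@lie g) y w = 0.
Implicit Types (k : {ffun 'I_n -> g}) (K : {ffun 'I_n -> g * A}) (s t : g * A).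

Definition wd K (w : seq 'I_n) s := foldr (fun i => sbr (K i)) s w.

Lemma wdB K w s t : wd K w (s - t) = wd K w s - wd K w t.
Proof. by elim: w => //= i w ->; rewrite sbrBr. Qed.

Lemma wd0 K w : wd K w 0 = 0.
Proof. by elim: w => //= i w ->; rewrite sbr0r. Qed.

Lemma wd_cat K v w s : wd K (v ++ w) s = wd K v (wd K w s).
Proof. exact: foldr_cat. Qed.

Lemma wd_rcons K w i s : wd K (rcons w i) s = wd K w (sbr (K i) s).
Proof. exact: foldr_rcons. Qed.

Lemma wd_fst K w s : (wd K w s).1 = foldr (@lie g) s.1 [seq (K i).1 | i <- w].
Proof. by elim: w => //= i w ->. Qed.

Lemma wd_fst0 K w s : size w = c -> (wd K w s).1 = 0.
Proof. by move=> sw; rewrite wd_fst g_nil // size_map. Qed.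

Definition injective_tuple (k : 'I_n -> g) :=
  forall a, (forall i, act (k i) a = 0) -> a = 0.

Definition regular K := injective_tuple (fun i => (K i).1).

(** The Fitting null component of the operators [sbr (K i)]. *)
Definition nullc K : set (g * A) :=
  [set s | forall w : seq 'I_n, size w = c -> wd K w s = 0].

Definition cartan K := regular K /\ forall i, nullc K (K i).

Lemma nullc_sub K : additive_subgroup (nullc K).
Proof.
split=> [w _|s t hs ht w sw]; first exact: wd0.
by rewrite wdB hs // ht // subrr.
Qed.

(** The innermost letter is peeled off: by induction every [sbr (K i) s] is zero, that is, all
    [(K i).1] annihilate [s.2]. *)
Lemma regular_words K m s : regular K -> s.1 = 0 ->
  (forall w, size w = m -> wd K w s = 0) -> s = 0.
Proof.
move=> iK; elim: m s => [|m IH] s s1 h; first exact: (h [::]).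
suff s2 : s.2 = 0 by apply: pair_ext.
apply: iK => i; have : sbr (K i) s = 0.
  apply: IH => [|w sw]; first by rewrite /sbr /= s1 lie0r.
  by rewrite -wd_rcons h // size_rcons sw.
by move=> /(congr1 snd); rewrite /sbr /= s1 act0l subr0.
Qed.

Lemma nullc_inj K s : regular K -> nullc K s -> s.1 = 0 -> s = 0.
Proof. by move=> iK hs s1; apply: (regular_words iK s1 hs). Qed.

Lemma nullc_inj2 K s t : regular K -> nullc K s -> nullc K t -> s.1 = t.1 -> s = t.
Proof.
move=> iK hs ht e; apply/eqP; rewrite -subr_eq0; apply/eqP; apply: (nullc_inj iK).
  exact: (nullc_sub K).2.
by rewrite /= e subrr.
Qed.

Lemma nullc_ad K i s : nullc K s -> nullc K (sbr (K i) s).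
Proof.
move=> hs w sw; rewrite -wd_rcons.
case: w sw => [|j w] sw /=.
  by have /= -> := hs [::] sw; rewrite sbr0r.
by rewrite (hs (rcons w i)) ?sbr0r // size_rcons -sw.
Qed.

(** By the Leibniz rule each letter of [w] falls on [s] or on [t]; among [p + q] letters, at least
    [p] fall on [s] or at least [q] on [t]. *)
Lemma wd_leibniz K p q s t :
  (forall w, size w = p -> wd K w s = 0) -> (forall w, size w = q -> wd K w t = 0) ->
  forall w, size w = (p + q)%N -> wd K w (sbr s t) = 0.
Proof.
elim: p q s t => [|p IHp] q s t hs.
  by move=> _ w _; have /= -> := hs [::] erefl; rewrite sbr0l wd0.
elim: q t => [|q IHq] t ht.
  by move=> w _; have /= -> := ht [::] erefl; rewrite sbr0r wd0.
case/lastP => [|w i]; first by rewrite addnS.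
rewrite size_rcons addnS => -[sw]; rewrite wd_rcons sbr_derivation.
rewrite -[sbr s _]opprK wdB -sub0r wdB wd0 sub0r opprK.
rewrite (IHp q.+1) //; first rewrite add0r; last by rewrite -addSnnS.
  apply: IHq => // v sv; rewrite -wd_rcons ht // size_rcons sv //.
by move=> v sv; rewrite -wd_rcons hs // size_rcons sv.
Qed.

(** The Leibniz rule only yields vanishing for words of length [c + c]. But after [c] letters the
    bracket lies in [A], since [g] is nilpotent, and there regularity removes the other [c]
    letters. *)
Lemma nullc_sbr K s t : regular K -> nullc K s -> nullc K t -> nullc K (sbr s t).
Proof.
move=> iK hs ht w sw; apply: (regular_words (m := c) iK); first exact: wd_fst0.
by move=> v sv; rewrite -wd_cat (wd_leibniz hs ht) // size_cat sv sw.
Qed.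

(** The letters of [K'] preserve the Lie subring [nullc K], and [c] of them lead into its
    intersection with [A], which is trivial. *)
Lemma nullc_sub_nullc K K' : regular K -> (forall i, nullc K (K' i)) ->
  forall s, nullc K s -> nullc K' s.
Proof.
move=> iK hK' s hs w sw.
suff h : nullc K (wd K' w s) by apply: (nullc_inj iK h); apply: wd_fst0.
by elim: w {sw} => //= i w IH; apply: nullc_sbr.
Qed.

Lemma nullc_eq K K' : cartan K -> regular K' -> (forall i, nullc K (K' i)) ->
  forall s, nullc K s <-> nullc K' s.
Proof.
move=> [iK hK] iK' hK' s; split; first exact: nullc_sub_nullc.
by apply: nullc_sub_nullc => // i; apply: (nullc_sub_nullc iK hK').
Qed.

(** The automorphism [exp (ad a)] up to sign, which implements the coboundaries. *)
Definition shift a s : g * A := (s.1, s.2 + act s.1 a).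

Definition shiftK a K : {ffun 'I_n -> g * A} := [ffun i => shift a (K i)].

Lemma shift_sbr a s t : shift a (sbr s t) = sbr (shift a s) (shift a t).
Proof.
apply: pair_ext => //=.
by rewrite !actDr act_lie opprD addrACA.
Qed.

Lemma shift_eq0 a s : shift a s = 0 <-> s = 0.
Proof.
split=> [[e1]|->]; last by rewrite /shift /= act0l addr0.
by rewrite e1 act0l addr0 => e2; apply: pair_ext.
Qed.

Lemma shift0 s : shift 0 s = s.
Proof. by rewrite /shift act0r addr0; case: s. Qed.

Lemma shift_ex a b s : shift a (shift b s) = shift (b + a) s.
Proof. by rewrite /shift /= -addrA -actDr. Qed.

Lemma wd_shift a K w s : wd (shiftK a K) w (shift a s) = shift a (wd K w s).
Proof. by elim: w => //= i w ->; rewrite ffunE shift_sbr. Qed.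

Lemma nullc_shift a K s : nullc (shiftK a K) (shift a s) <-> nullc K s.
Proof.
by split=> h w /h; rewrite wd_shift => /shift_eq0.
Qed.

Lemma regular_shift a K : regular (shiftK a K) <-> regular K.
Proof. by split=> h b hb; apply: h => i; have := hb i; rewrite ffunE. Qed.

Lemma cartan_shift a K : cartan K -> cartan (shiftK a K).
Proof.
move=> [iK hK]; split; first exact/regular_shift.
by move=> i; rewrite ffunE; apply/nullc_shift.
Qed.

Definition Aconj K K' := exists a, forall s, nullc K s <-> nullc K' (shift a s).

Lemma Aconj_equiv D : equivalence_on D Aconj.
Proof.
split=> [K _|K K' _ _ [a h]|K K' K'' _ _ _ [a h] [b h']].
- by exists 0 => s; rewrite shift0.
- by exists (- a) => s; rewrite h shift_ex addNr shift0.
- by exists (a + b) => s; rewrite h h' shift_ex.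
Qed.

Lemma Aconj_common K K1 K2 : Aconj K K1 -> Aconj K K2 -> Aconj K1 K2.
Proof.
have [_ sym trans] := Aconj_equiv setT.
by move=> /(sym _ _ I I) h h'; apply: (trans _ K).
Qed.

Lemma Aconj_shiftK a K K' : (forall s, nullc K s <-> nullc K' s) -> Aconj K (shiftK a K').
Proof. by move=> h; exists a => s; rewrite nullc_shift. Qed.

(** Since [sbr] of a word is an iterated commutator of the [sbr (K j)], it preserves what they
    preserve. This holds before the [K i] are known to lie in [nullc K], and serves to prove that
    they do. *)
Lemma wd_normalises K w i s : nullc K s -> nullc K (sbr (wd K w (K i)) s).
Proof.
elim: w s => [|j w IH] s hs /=; first exact: nullc_ad.
rewrite (_ : sbr _ s = sbr (K j) (sbr (wd K w (K i)) s) - sbr (wd K w (K i)) (sbr (K j) s)).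
  by apply: (nullc_sub K).2; [apply/nullc_ad/IH | apply/IH/nullc_ad].
by rewrite sbr_derivation addrK.
Qed.

(** * From an almost derivation to a Cartan family *)

Section Derivation.
Hypothesis H0 : forall a, finite_set [set act x a | x in setT] -> a = 0.
Variables (f : g -> A) (k : 'I_n -> g) (H : 'I_n -> set g).
Hypotheses (f0 : f 0 = 0) (k_inj : injective_tuple k).
Hypotheses (H_sub : forall i, additive_subgroup (H i)) (H_fi : forall i, finite_index (H i)).
Hypothesis f_der : forall i y, H i y -> f (lie (k i) y) = act (k i) (f y) - act y (f (k i)).

Let K : {ffun 'I_n -> g * A} := [ffun i => (k i, f (k i))].

Let iK : regular K.
Proof. by move=> a ha; apply: k_inj => i; have := ha i; rewrite ffunE. Qed.

(** The points at which [f_der] can be applied [m] times in succession, whichever letters [k i] are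
    chosen. *)
Fixpoint derdom m : set g :=
  if m is m'.+1 then [set x | forall i, H i x /\ derdom m' (lie (k i) x)] else setT.

Let derdom_fi m : additive_subgroup (derdom m) /\ finite_index (derdom m).
Proof.
elim: m => [|m [IHs IHf]] /=; first by split; [|exact: finite_indexT].
split.
  apply: (@additive_subgroup_all _ _ (fun i => H i `&` [set x | derdom m (lie (k i) x)])) => i.
  apply: additive_subgroupI => //; split=> [|x y hx hy]; first by rewrite /= lie0r; case: IHs.
  by rewrite /= lieBr; apply: IHs.2.
apply: (@finite_index_all _ _ (fun i => H i `&` [set x | derdom m (lie (k i) x)])) => i.
apply: finite_indexI => //; apply: finite_index_pre => // x y; exact: lieBr.
Qed.

Let wd_graph m w x : size w = m -> derdom m x ->
  wd K w (x, f x) = ((wd K w (x, f x)).1, f (wd K w (x, f x)).1).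
Proof.
elim/last_ind: w m x => [|w i IH] [|m] x //; rewrite size_rcons //.
by move=> -[sw] /(_ i)[Hx dx]; rewrite wd_rcons ffunE /sbr /= -f_der // (IH m).
Qed.

Lemma nullc_graph x : derdom c x -> nullc K (x, f x).
Proof. by move=> dx w sw; rewrite (wd_graph sw dx) wd_fst0 // f0. Qed.

Lemma cartan_graph : cartan K.
Proof.
(* A word [s] of length [c] lies in [A] and normalises [nullc K], which meets [A]
   trivially; so the projection of [nullc K], of finite index, kills [s]. *)
split=> // i w sw; set s := wd K w (K i).
have s1 : s.1 = 0 by exact: wd_fst0.
suff s2 : s.2 = 0 by apply: pair_ext.
have [d_sub d_fi] := derdom_fi c.
have ds x : derdom c x -> act x s.2 = 0.
  move=> dx; have := wd_normalises w i (nullc_graph dx).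
  rewrite -/s => /(nullc_inj iK); rewrite {1}/sbr /= s1 lie0l => /(_ erefl).
  by move=> /(congr1 snd) /=; rewrite s1 act0l sub0r => /eqP; rewrite oppr_eq0 => /eqP.
apply: H0; have [F [finF FT]] := finite_index_fcov d_sub.1 d_fi.
apply: sub_finite_set (finite_image (fun x => act x s.2) finF).
move=> _ [x _ <-]; have [r Fr dr] := FT x I; exists r => //.
by apply/eqP; rewrite eq_sym -subr_eq0 -actBl ds.
Qed.

Lemma derivation_cartan : cartan K /\ exists H', [/\ additive_subgroup H',
  finite_index H' & forall x, H' x -> nullc K (x, f x)].
Proof.
split; first exact: cartan_graph.
by exists (derdom c); have [? ?] := derdom_fi c; split=> //; exact: nullc_graph.
Qed.
End Derivation.
End Words.
End LieTheory.

(** * Counting Cartan families *)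

Lemma finite_ffun n (X : choiceType) (F : set X) :
  finite_set F -> finite_set [set r : {ffun 'I_n -> X} | forall i, F (r i)].
Proof.
move=> /finite_seqP[s ->].
pose h (u : {ffun 'I_n -> seq_sub s}) : {ffun 'I_n -> X} := [ffun i => val (u i)].
apply: sub_finite_set (finite_image h (@finite_finset _ setT)) => r rs.
exists [ffun i => SeqSub (rs i)] => //.
by apply/ffunP => i; rewrite !ffunE.
Qed.

Section Counting.
Variables (L : language) (T : theory L) (M : structure L).
Variable dim : forall (M : structure L) (n : nat), set (set (n.-tuple M)) -> dimension.
Hypotheses (Hdim : dimension_on T dim) (HM : models T M).
Local Notation dm := (setdim dim).

Lemma dset_ffun n X (sX : isort M X) (D : set X) :
  dset D -> dset [set r : {ffun 'I_n -> X} | forall i, D (r i)].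
Proof. by move=> dD; apply: dset_allfin => i; apply: dset_pre dD (dmap_app i). Qed.

Lemma dm_ffun n X (sX : isort M X) (D : set X) x0 : dset D -> D x0 ->
  dm [set r : {ffun 'I_n -> X} | forall i, D (r i)] = (n * dm D)%N.
Proof.
move=> dD Dx0; elim: n => [|n IH].
  apply/(dm_eq0 Hdim HM); first exact: dset_ffun.
  apply: (@sub_finite_set _ _ [set [ffun=> x0]]); last exact: finite_set1.
  by move=> r _; apply/ffunP => -[].
pose tl (r : {ffun 'I_n.+1 -> X}) : {ffun 'I_n -> X} := [ffun i => r (lift ord0 i)].
have dtl : dmap tl by rewrite /tl; apply: (dmap_finfun (F := fun i (r : {ffun 'I_n.+1 -> X}) => r (lift ord0 i))) => i; exact: dmap_app.
have dn1 := @dset_ffun n.+1 X sX D dD; have dn := @dset_ffun n X sX D dD.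
have htl (r : {ffun 'I_n.+1 -> X}) : (forall i, D (r i)) -> forall i, D (tl r i) by move=> Dr i; rewrite ffunE.
pose cs x (r : {ffun 'I_n -> X}) : {ffun 'I_n.+1 -> X} :=
  [ffun i => if unlift ord0 i is Some j then r j else x].
have cs0 x r : cs x r ord0 = x by rewrite ffunE unlift_none.
have tlcs x r : tl (cs x r) = r by apply/ffunP => i; rewrite !ffunE liftK.
have csD x (r : {ffun 'I_n -> X}) : D x -> (forall i, D (r i)) -> forall i, D (cs x r i).
  by move=> Dx Dr i; rewrite ffunE; case: unliftP.
rewrite mulSn addnC -IH; apply/eqP; rewrite eqn_leq; apply/andP; split.
  apply: (dm_lower Hdim HM dn1 dn dtl) => // r Dr.
  apply: (dm_inj Hdim HM (f := fun r : {ffun 'I_n.+1 -> X} => r ord0)) => //.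
  - exact: dset_fiber.
  - exact: dmap_app.
  - by move=> r' [].
  - move=> r1 r2 [_ e1] [_ e2] e0; apply/ffunP => i.
    case: (unliftP ord0 i) => [j ->|-> //].
    by have := congr1 (fun r' : {ffun 'I_n -> X} => r' j) (etrans e1 (esym e2)); rewrite !ffunE.
apply: (dm_upper Hdim HM dn1 dn dtl (y0 := [ffun=> x0])) => //.
- by move=> i; rewrite ffunE.
- by move=> r Dr; exists (cs x0 r) => //; exact: csD.
move=> r Dr; apply: (dm_inj Hdim HM (f := fun x => cs x r)) => //.
- exact: dset_fiber.
- rewrite /cs; apply: (dmap_finfun (F := fun i x => if unlift ord0 i is Some j then r j else x)) => i.
  by case: unlift => [j|]; [exact: dmap_cst | exact: dmap_id].
- by move=> x Dx; split; [exact: csD | exact: tlcs].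
- by move=> x y _ _ e; rewrite -(cs0 x r) e cs0.
Qed.

Variables (g : lieRingType) (A : lieModType g).
Variables (sg : isort M g) (sA : isort M A).
Hypotheses (dg : dzmod g) (dA : dzmod A).
Hypotheses (dlie : dmap (fun p : g * g => lie p.1 p.2)).
Hypotheses (dact : dmap (fun p : g * A => act p.1 p.2)).

Section Definable.
Variables (X : Type) (sX : isort M X).

Lemma dmap_lie (f h : X -> g) : dmap f -> dmap h -> dmap (fun x => lie (f x) (h x)).
Proof. by move=> df dh; apply: dmap_comp dlie (dmap_pair df dh). Qed.

Lemma dmap_act (f : X -> g) (h : X -> A) :
  dmap f -> dmap h -> dmap (fun x => act (f x) (h x)).
Proof. by move=> df dh; apply: dmap_comp dact (dmap_pair df dh). Qed.

Lemma dmap_sbr (f h : X -> g * A) : dmap f -> dmap h -> dmap (fun x => sbr (f x) (h x)).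
Proof.
move=> df dh.
have f1 : dmap (fun x => (f x).1) by exact: dmap_comp dmap_fst df.
have f2 : dmap (fun x => (f x).2) by exact: dmap_comp dmap_snd df.
have h1 : dmap (fun x => (h x).1) by exact: dmap_comp dmap_fst dh.
have h2 : dmap (fun x => (h x).2) by exact: dmap_comp dmap_snd dh.
by apply: dmap_pair; [exact: dmap_lie | apply: dmapB => //; exact: dmap_act].
Qed.

Lemma dmap_shift (f : X -> A) (h : X -> g * A) : dmap f -> dmap h -> dmap (fun x => shift (f x) (h x)).
Proof.
move=> df dh.
have h1 : dmap (fun x => (h x).1) by exact: dmap_comp dmap_fst dh.
have h2 : dmap (fun x => (h x).2) by exact: dmap_comp dmap_snd dh.
by apply: dmap_pair => //; apply: dmapD => //; exact: dmap_act.
Qed.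

End Definable.

Section DefinableTuples.
Variables (X : Type) (sX : isort M X) (n c : nat).

Lemma dmap_coord Y (sY : isort M Y) (f : X -> {ffun 'I_n -> Y}) i :
  dmap f -> dmap (fun x => f x i).
Proof. by move=> df; apply: dmap_comp (dmap_app i) df. Qed.

Lemma dset_nullc (f : X -> {ffun 'I_n -> g * A}) (h : X -> g * A) :
  dmap f -> dmap h -> dset (fun x => nullc c (f x) (h x)).
Proof.
move=> df dh.
have dw (w : seq 'I_n) : dmap (fun x => wd (f x) w (h x)).
  by elim: w => //= i w IH; apply: dmap_sbr => //; exact: dmap_coord.
have d1 (w : c.-tuple 'I_n) : dset (fun x => wd (f x) w (h x) = 0).
  by apply: dset_eq => //; exact: dmap_cst.
apply: dset_ext (dset_allfin d1) => x; split=> [H w sw|H w]; last by rewrite H ?size_tuple.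
by have /eqP sw' := sw; exact: (H (Tuple sw')).
Qed.

Lemma dset_injective_tuple (f : 'I_n -> X -> g) :
  (forall i, dmap (f i)) -> dset (fun x => injective_tuple A (fun i => f i x)).
Proof.
move=> df; apply: dset_all; apply: dset_imp; last first.
  by apply: dset_eq; [exact: dmap_snd | exact: dmap_cst].
apply: dset_allfin => i; apply: dset_eq; last exact: dmap_cst.
by apply: dmap_act; [exact: dmap_comp (df i) dmap_fst | exact: dmap_snd].
Qed.

Lemma dset_regular (f : X -> {ffun 'I_n -> g * A}) : dmap f -> dset (fun x => regular (f x)).
Proof.
move=> df; apply: dset_injective_tuple => i.
by apply: dmap_comp dmap_fst _; exact: dmap_coord.
Qed.

Lemma dset_cartan (f : X -> {ffun 'I_n -> g * A}) : dmap f -> dset (fun x => cartan c (f x)).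
Proof.
move=> df; apply: dset_and; first exact: dset_regular.
by apply: dset_allfin => i; apply: dset_nullc => //; exact: dmap_coord.
Qed.
End DefinableTuples.

Lemma dset_iff X (sX : isort M X) (D E : X -> Prop) :
  dset D -> dset E -> dset (fun x => D x <-> E x).
Proof. by move=> dD dE; apply: dset_and; apply: dset_imp. Qed.

Lemma dset_Aconj n c : dset (fun p : {ffun 'I_n -> g * A} * {ffun 'I_n -> g * A} => Aconj c p.1 p.2).
Proof.
apply: dset_ex; apply: dset_all; apply: dset_iff; apply: dset_nullc.
- exact: dmap_comp dmap_fst (dmap_comp dmap_fst dmap_fst).
- exact: dmap_snd.
- exact: dmap_comp dmap_snd (dmap_comp dmap_fst dmap_fst).
- by apply: dmap_shift; [exact: dmap_comp dmap_snd dmap_fst | exact: dmap_snd].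
Qed.

Variable c : nat.
Hypothesis c_gt0 : (0 < c)%N.
Hypothesis g_nil : forall (w : seq g) y, size w = c -> foldr (@lie g) y w = 0.
Hypothesis H0 : forall a : A, finite_set [set act x a | x in setT] -> a = 0.

Local Notation d := (@setdim L M dim g sg [set: g]).
Local Notation al := (@setdim L M dim A sA [set: A]).
Local Notation n := al.+1.

(** The annihilator is the kernel of [x |-> act x a], whose image is infinite by [H0] and so has
    positive dimension. *)
Lemma dm_ann (a : A) : a != 0 -> (dm [set x : g | act x a = 0%R] < d)%N.
Proof.
move=> a0; have da : dmap (fun x : g => act x a).
  by apply: dmap_act; [exact: dmap_id | exact: dmap_cst].
rewrite [d](dm_hom Hdim HM dg da dset_True (additive_subgroupT g)
  (fun x y _ _ => actBl x y a)).
rewrite (_ : [set x | [set: g] x /\ _] = [set x | act x a = 0]); last first.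
  by apply/seteqP; split=> x // [].
rewrite -[ltnLHS]add0n ltn_add2r lt0n; apply: contra_neq a0 => e.
by apply: H0; apply/(dm_eq0 Hdim HM) => //; apply: dset_image => //; exact: dset_True.
Qed.

Let W : set {ffun 'I_n -> g} := [set k | ~ injective_tuple A k].

Let dW : dset W.
Proof. by apply: dset_not; apply: dset_injective_tuple => i; exact: dmap_app. Qed.

(* The tuples killing a given [a] have dimension at most [n * d.-1]; the number
   [n = al.+1] of components makes up for the [al] parameters of [a]. *)
Let dm_W k : W k -> (dm W < n * d)%N.
Proof.
move=> /existsNP[a0 /not_implyP[_ /eqP a00]].
have d_gt0 : (0 < d)%N by apply: leq_trans (dm_ann a00).
pose W0 : set ({ffun 'I_n -> g} * A) :=
  [set p : {ffun 'I_n -> g} * A | (forall i, act (p.1 i) p.2 = 0) /\ p.2 <> 0].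
have dW0 : dset W0.
  apply: dset_and; last by apply: dset_not; apply: dset_eq; [exact: dmap_snd | exact: dmap_cst].
  apply: dset_allfin => i; apply: dset_eq; last exact: dmap_cst.
  by apply: dmap_act; [apply: dmap_coord; exact: dmap_fst | exact: dmap_snd].
apply: (@leq_ltn_trans (dm W0)).
  apply: (dm_surj Hdim HM (f := fst)) => //; first exact: dmap_fst.
  by move=> {}k /existsNP[a /not_implyP[h ne]]; exists (k, a).
have dne : dset [set a : A | a <> 0].
  by apply: dset_not; apply: dset_eq; [exact: dmap_id | exact: dmap_cst].
apply: (@leq_ltn_trans (al + n * d.-1)).
  apply: (@leq_trans (dm [set a : A | a <> 0%R] + n * d.-1)).
    apply: (dm_lower Hdim HM (f := snd)) => //; first exact: dmap_snd.
    - by move=> p [].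
    - move=> a /eqP ne; have dann : dset [set x : g | act x a = 0].
        by apply: dset_eq; [apply: dmap_act; [exact: dmap_id | exact: dmap_cst] | exact: dmap_cst].
      apply: (@leq_trans (n * dm [set x : g | act x a = 0%R])); last first.
        by rewrite leq_mul2l -ltnS prednK // dm_ann.
      rewrite -(@dm_ffun n _ _ _ 0) //; last exact: act0l.
      apply: (dm_inj Hdim HM (f := fst)) => //.
      + by apply: dset_fiber => //; exact: dmap_snd.
      + exact: dset_ffun.
      + exact: dmap_fst.
      + by move=> p [[h _] e] i; rewrite /= -e.
      + by move=> p q [_ e] [_ e'] e0; apply: pair_ext => //; rewrite e.
  by rewrite leq_add2r; apply: (dm_le Hdim HM) => //; exact: dset_True.
by rewrite -{2}(prednK d_gt0) mulnS ltn_add2r.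
Qed.

Lemma generic_fcov (D : set {ffun 'I_n -> g}) : dset D ->
  fcov [set k | D k \/ W k] setT -> (exists k, D k) /\ (n * d <= dm D)%N.
Proof.
move=> dD cov.
have nd : (n * d <= dm [set: {ffun 'I_n -> g}])%N.
  rewrite -(@dm_ffun n _ _ _ 0) //; last exact: dset_True.
  by apply: (dm_le Hdim HM) => //; [exact/dset_ffun/dset_True | exact: dset_True].
have := dm_fcov Hdim HM (dzmod_ffun n dg) (dset_or dD dW) dset_True cov.
move=> /(leq_trans nd).
rewrite (dmU Hdim HM dD dW) => h.
(* The case of empty [W] is apart because the strict bound [dm_W] fails there when [d = 0]. *)
have [[k Wk]|nW] := pselect (exists k, W k).
  have lt := dm_W Wk.
  have le : (n * d <= dm D)%N by move: h; rewrite leq_max [X in _ || X]leqNgt lt orbF.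
  split=> //; apply: contrapT => nD.
  have e : D = set0 by apply/seteqP; split=> // x Dx; apply: nD; exists x.
  move: (leq_trans lt le); by rewrite e (dm0 Hdim HM) ltn0.
have W0 : W = set0 by apply/seteqP; split=> // x Wx; apply: nW; exists x.
split; last by move: h; rewrite W0 (dm0 Hdim HM) maxn0.
have [F [_ /(_ 0 I)[r _ [Dr|Wr]]]] := cov; first by exists (0 - r).
by case: nW; exists (0 - r).
Qed.

Lemma fcov_ffun (m : nat) (V : zmodType) (H : set V) : fcov H setT ->
  fcov [set k : {ffun 'I_m -> V} | forall i, H (k i)] setT.
Proof.
move=> [F [finF FH]]; exists [set r : {ffun 'I_m -> V} | forall i, F (r i)]; split; first exact: finite_ffun.
move=> k _; have h i : exists r, F r /\ H (k i - r) by have [r] := FH (k i) I; exists r.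
have [r rP] := choice h; exists (finfun r) => i; rewrite !ffunE; by case: (rP i).
Qed.

(* [H] need not be definable: if [H ^ n] misses the injective tuples, translates
   of the definable set [W] cover everything. *)
Lemma exists_injective_tuple (H : set g) : fcov H setT ->
  exists k : 'I_n -> g, injective_tuple A k /\ forall i, H (k i).
Proof.
move=> /(fcov_ffun n)[F [finF FH]]; apply: contrapT => nk.
have d0 : dset (@set0 {ffun 'I_n -> g}) by apply: dset_ext (dset_not dset_True) => x; split.
have [|[k []] _] // := @generic_fcov set0 d0.
exists F; split=> // k /FH[r Fr Hk]; exists r => //; right => ik.
by apply: nk; exists (k - r).
Qed.
Section Null.
Variables (m : nat) (K : {ffun 'I_m -> g * A}).
Hypothesis cK : cartan c K.

Let wop_sbr w j s : wop (fun i => sbr (K i)) w j s = sbr (wd K w (K j)) s.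
Proof.
elim: w s => //= i w IH s; rewrite /brk !IH.
by rewrite sbr_derivation addrK.
Qed.

(** The bracket words of the [sbr (K i)] are the [sbr (wd K w (K j))], which vanish at length [c]
    because [K] is Cartan. The component [u] given by [fitting] lies in [nullc c K], since words of
    length [c] bring it into [A]. *)
Lemma nullc_fcov : fcov [set x | exists b, nullc c K (x, b)] setT.
Proof.
have iter_fst k (s t : g * A) : (iter k (sbr s) t).1 = foldr (@lie g) t.1 (nseq k s.1).
  by elim: k => //= k ->.
have [||||||||||F [finF FT]] := @fitting L T M dim Hdim HM (g * A)%type _ (dzmod_prod dg dA)
    [set: g * A] [set s | s.1 = 0] m c (fun i => sbr (K i)) dset_True.
- exact: additive_subgroupT.
- by split=> // s t /= -> ->; rewrite subrr.
- by [].
- by move=> i; apply: dmap_sbr; [exact: dmap_cst | exact: dmap_id].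
- by move=> i s t; apply: sbrBr.
- by [].
- by move=> i s /= s1; rewrite s1 lie0r.
- by move=> w j s sw _; rewrite wop_sbr (proj2 cK) // sbr0l.
- move=> w j s _; rewrite (_ : wop _ w j = sbr (wd K w (K j))); last by apply/funext => t; exact: wop_sbr.
  by rewrite /= iter_fst g_nil // size_nseq.
- move=> [x a] /= -> h; apply: pair_ext => //=; apply: (proj1 cK) => i.
  by have /(congr1 snd) := h i; rewrite /sbr /= act0l subr0.
exists (fst @` F); split; first exact: finite_image.
move=> x _; have [r [a [u [Fr a1 _ e hu]]]] := FT (x, 0) I.
exists r.1; first by exists r.
exists u.2; rewrite (_ : x - r.1 = u.1); last first.
  by have /(congr1 fst) /= -> := e; rewrite a1 add0r addrC addKr.
by move=> w sw; rewrite -surjective_pairing; apply: hu; apply: (wd_fst0 g_nil).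
Qed.
End Null.

(** * Cartan families over a fixed tuple *)

Section Fiber.
Variables (m : nat) (k : {ffun 'I_m -> g}).
Hypothesis ik : injective_tuple A k.

Local Notation V := {ffun 'I_m -> A}.
Let K (b : V) : {ffun 'I_m -> g * A} := [ffun i => (k i, b i)].
(** Extension of a trivial module [V] by [A] whose cocycle at [b] is [b] itself. Bracket words of
    the [t i] at [(0, b)] compute the [A]-components of the words [wd (K b) w (K b j)]. *)
Let t (i : 'I_m) (s : A * V) : A * V := (act (k i) s.1 + s.2 i, 0).

Let tB i s s' : t i (s - s') = t i s - t i s'.
Proof.
apply: pair_ext; rewrite /= ?subrr //.
by rewrite actBr !ffunE opprD addrACA.
Qed.

Let kw w j := foldr (@lie g) (k j) [seq k i | i <- w].

Let wd_kw b w j : (wd (K b) w (K b j)).1 = kw w j.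
Proof. by rewrite wd_fst ffunE /=; congr foldr; apply: eq_map => i; rewrite ffunE. Qed.

Let wd_K0 w j : (wd (K 0) w (K 0 j)).2 = 0.
Proof.
elim: w => [|i w IH] /=; first by rewrite !ffunE.
by rewrite IH act0r !ffunE act0r subrr.
Qed.

Let wop_wd w j s : wop t w j s = (act (kw w j) s.1 + (wd (K s.2) w (K s.2 j)).2, 0).
Proof.
elim: w s => [|i w IH] s; first by rewrite /= /t ffunE.
rewrite [LHS]/= /brk !IH /t /= wd_kw wd_K0 !addr0 /kw /= -/(kw w j) ffunE /=.
apply: pair_ext; rewrite /= ?subr0 //.
rewrite act_lie !actDr opprD !ffunE !addr0 -!addrA; congr (_ + _).
by rewrite addrCA.
Qed.

Let Z := [set b : V | forall j, nullc c (K b) (K b j)].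

(** Makes the Cartan condition additive in [b]: [Z] is a subgroup although it is cut out by iterated
    brackets. *)
Let ZP b : Z b <-> forall w j, size w = c -> wop t w j (0, b) = 0.
Proof.
have e w j : size w = c -> wop t w j (0, b) = 0 <-> wd (K b) w (K b j) = 0.
  move=> sw; rewrite wop_wd /= act0r add0r; split=> [[h]|->//].
  by apply: pair_ext => //; exact: (wd_fst0 g_nil).
by split=> [h w j sw|h j w sw]; [apply/e => //; exact: h | apply/e => //; exact: h].
Qed.

Let Z_sub : additive_subgroup Z.
Proof.
have spanw w j : lspan t 1 (wop t w j) by exact: lspan_word.
split=> [|b b' /ZP hb /ZP hb']; apply/ZP => w j sw; first exact: (lspan0 tB (spanw w j)).
rewrite (_ : (0, b - b') = (0, b) - (0, b') :> A * V); last by apply: pair_ext; rewrite /= ?subrr.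
by rewrite (lspanB tB (spanw w j)) hb // hb' // subrr.
Qed.

Let dK X (sX : isort M X) (f : X -> V) : dmap f -> dmap (fun x => K (f x)).
Proof.
move=> df; apply: (dmap_finfun (F := fun i x => (k i, f x i))) => i.
by apply: dmap_pair; [exact: dmap_cst | exact: dmap_coord].
Qed.

Let dZ : dset Z.
Proof.
apply: dset_allfin => j; apply: dset_nullc; first exact: dK dmap_id.
by apply: dmap_coord; exact: dK dmap_id.
Qed.

(* On [A * Z], the operators [t i] exhibit [Z] as an extension by [A] of a trivial
   module, which splits up to finite index. *)
Lemma dm_cartan_fiber : (dm [set b : V | forall j, nullc c (K b) (K b j)] <= al)%N.
Proof.
have dt i : dmap (t i).
  apply: dmap_pair; last exact: dmap_cst.
  apply: dmapD => //; last by apply: dmap_coord; exact: dmap_snd.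
  by apply: dmap_act; [exact: dmap_cst | exact: dmap_fst].
have dS0 : dset [set s : A * V | Z s.2] by exact: dset_pre dZ dmap_snd.
have [||||||||||F [finF FS]] := @fitting L T M dim Hdim HM (A * V)%type _
    (dzmod_prod dA (dzmod_ffun m dA)) [set s | Z s.2] [set s | s.2 = 0] m c t dS0.
- split=> [|s s' hs hs']; first by case: Z_sub.
  exact: Z_sub.2.
- by split=> // s s' /= -> ->; rewrite subrr.
- by move=> s /= ->; case: Z_sub.
- exact: dt.
- exact: tB.
- by move=> i s _; case: Z_sub.
- by [].
- move=> w j [a b] sw /= Zb.
  rewrite (_ : (a, b) = (a, 0) + (0, b)); last by apply: pair_ext; rewrite /= ?addr0 ?add0r.
  rewrite (lspanD tB _ _ (@lspan_word _ _ t 1 w j isT)) (proj1 (ZP b) Zb) // addr0.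
  by rewrite wop_wd /= wd_K0 /kw g_nil ?size_map // act0l addr0.
(* A single application already lands in [A]; [c] must be positive for there to be one. *)
- move=> w j s Zs; rewrite -(prednK c_gt0) /=.
  by rewrite wop_wd.
- by move=> [a b] /= -> h; rewrite (ik (a := a)) // => i; have [] := h i; rewrite ffunE addr0.
pose kA := [set [ffun i => act (k i) a] | a in [set: A]] : set V.
have dkA : dmap (fun a => [ffun i => act (k i) a] : V).
  apply: (dmap_finfun (F := fun i a => act (k i) a)) => i.
  by apply: dmap_act; [exact: dmap_cst | exact: dmap_id].
have dkA' : dset kA by apply: dset_image => //; exact: dset_True.
apply: (@leq_trans (dm kA)); last first.
  apply: (dm_surj Hdim HM (f := fun a => [ffun i => act (k i) a] : V)) => //; exact: dset_True.
apply: (dm_fcov Hdim HM (dzmod_ffun m dA)) => //.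
exists (snd @` F); split; first exact: finite_image.
move=> b Zb; have [|r [a [u [Fr a2 _ e hu]]]] := FS (0, b); first exact: Zb.
exists r.2; first by exists r.
(* The vector [t i u] lies in [A], so [fitting] makes it zero: [u.2 i] is the value of [k i] at
   [- u.1]. *)
exists (- u.1) => //; apply/ffunP => i.
rewrite (_ : b - r.2 = u.2); last by have /(congr1 snd) /= -> := e; rewrite a2 add0r addrC addKr.
have [] : t i u = 0 by exact: (hu [:: i]).
by rewrite ffunE actNr => /eqP; rewrite addrC addr_eq0 => /eqP ->.
Qed.
End Fiber.
Local Notation family := {ffun 'I_n -> g * A}.

Let dmap_fsts X (sX : isort M X) (f : X -> family) : dmap f ->
  dmap (fun x => [ffun i => (f x i).1] : {ffun 'I_n -> g}).
Proof.
move=> df; apply: (dmap_finfun (F := fun i x => (f x i).1)) => i.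
by apply: dmap_comp dmap_fst _; exact: dmap_coord.
Qed.

Let dmap_snds X (sX : isort M X) (f : X -> family) : dmap f ->
  dmap (fun x => [ffun i => (f x i).2] : {ffun 'I_n -> A}).
Proof.
move=> df; apply: (dmap_finfun (F := fun i x => (f x i).2)) => i.
by apply: dmap_comp dmap_snd _; exact: dmap_coord.
Qed.

Lemma dm_cartan : (dm [set K : family | cartan c K] <= n * d + al)%N.
Proof.
have dC : dset [set K : family | cartan c K] by apply: dset_cartan; exact: dmap_id.
have df := dmap_fsts (@dmap_id _ _ family _).
apply: (@leq_trans (dm [set: {ffun 'I_n -> g}] + al)); last first.
  rewrite leq_add2r -(@dm_ffun n _ _ _ 0) //; last exact: dset_True.
  by apply: (dm_le Hdim HM) => //; [exact: dset_True | exact/dset_ffun/dset_True].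
apply: (dm_lower Hdim HM dC _ df) => //; first exact: dset_True.
move=> k _; have [ik|nk] := pselect (injective_tuple A k); last first.
  rewrite (_ : [set K | _] = set0) ?(dm0 Hdim HM) //.
  apply/seteqP; split=> // K [[iK _] e]; apply: nk => a ha; apply: iK => i.
  by rewrite -(ha i) -e ffunE.
apply: leq_trans (dm_cartan_fiber ik).
have e (K : family) : [ffun i => (K i).1] = k ->
    [ffun i => (k i, [ffun j => (K j).2] i)] = K.
  by move=> <-; apply/ffunP => i; rewrite !ffunE -surjective_pairing.
apply: (dm_inj Hdim HM (f := fun K : family => [ffun i => (K i).2] : {ffun 'I_n -> A})).
- exact: dset_fiber.
- apply: dset_allfin => j.
  have dK : dmap (fun b : {ffun 'I_n -> A} => [ffun i => (k i, b i)] : family).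
    apply: (dmap_finfun (F := fun i (b : {ffun 'I_n -> A}) => (k i, b i))) => i.
    by apply: dmap_pair; [exact: dmap_cst | exact: dmap_app].
  by apply: dset_nullc => //; exact: dmap_coord.
- by apply: dmap_snds; exact: dmap_id.
- by move=> K [[_ hK] /e eK] j; rewrite /= eK.
- by move=> K K' [_ /e eK] [_ /e eK'] E; rewrite -eK E eK'.
Qed.

(* The class of [K0] contains the conjugates by [A] of all the families with the
   same null component. *)
Lemma dm_class (K0 : family) : cartan c K0 ->
  (n * d + al <= dm [set K : family | cartan c K /\ Aconj c K0 K])%N.
Proof.
move=> cK0; have [iK0 hK0] := cK0.
pose P := [set K : family | regular K /\ forall i, nullc c K0 (K i)].
pose Q := [set k : {ffun 'I_n -> g} | injective_tuple A k /\ forall i, exists b, nullc c K0 (k i, b)].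
have dP : dset P.
  apply: dset_and; first by apply: dset_regular; exact: dmap_id.
  by apply: dset_allfin => i; apply: dset_nullc; [exact: dmap_cst | exact: dmap_app].
have dQ : dset Q.
  apply: dset_and; first by apply: dset_injective_tuple => i; exact: dmap_app.
  apply: dset_allfin => i; apply: dset_ex; apply: dset_nullc; first exact: dmap_cst.
  by apply: dmap_pair; [apply: dmap_coord; exact: dmap_fst | exact: dmap_snd].
have le1 : (n * d <= dm Q)%N.
  apply: (proj2 (generic_fcov dQ _)).
  have [F [finF FT]] := fcov_ffun n (nullc_fcov cK0).
  exists F; split=> // k /FT[r Fr hr]; exists r => //.
  by have [ik|nk] := pselect (injective_tuple A (k - r)); [left | right].
have le2 : (dm Q <= dm P)%N.
  apply: (dm_surj Hdim HM dP dQ (dmap_fsts dmap_id)).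
  move=> k [ik /choice[b hb]]; exists [ffun i => (k i, b i)].
    split=> [a ha|i]; last by rewrite ffunE.
    by apply: ik => i; have := ha i; rewrite ffunE.
  by apply/ffunP => i; rewrite !ffunE.
have dAP : dset (fun p : A * family => [set: A] p.1 /\ P p.2).
  by apply: dset_and; [exact: dset_True | exact: dset_pre dP dmap_snd].
rewrite addnC; apply: leq_trans (leq_add (leqnn _) (leq_trans le1 le2)) _.
have PK0 : P K0 by [].
apply: leq_trans (dm_prod_ge Hdim HM (D := [set: A]) (x0 := 0) dset_True dP I PK0) _.
apply: (dm_inj Hdim HM (f := fun p : A * family => shiftK p.1 p.2)) => //.
- apply: dset_and; first by apply: dset_cartan; exact: dmap_id.
  apply: (dset_pre (f := fun K => (K0, K)) (dset_Aconj _ _)).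
  by apply: dmap_pair; [exact: dmap_cst | exact: dmap_id].
- apply: (dmap_finfun (F := fun i (p : A * family) => shift p.1 (p.2 i))) => i.
  by apply: dmap_shift; [exact: dmap_fst | apply: dmap_coord; exact: dmap_snd].
- move=> [a K] /= [_ [iK hK]].
  have e := nullc_eq g_nil cK0 iK hK.
  split; last exact: Aconj_shiftK.
  by apply: cartan_shift; split=> // i; apply/e.
- move=> [a K] [b K'] /= [_ [iK hK]] [_ [iK' hK']] E.
  (* A shift keeps the first component, which determines a point of [nullc c K0]; so the families
     agree, and their regularity then gives [a = b]. *)
  have e i : K i = K' i /\ act (K i).1 (a - b) = 0.
    have := congr1 (fun r : family => r i) E; rewrite !ffunE => -[e1 e2].
    have eK : K i = K' i by exact: (nullc_inj2 iK0).
    by split=> //; move: e2; rewrite -eK => /addrI; rewrite actBr => ->; rewrite subrr.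
  congr (_, _); last by apply/ffunP => i; case: (e i).
  by apply/eqP; rewrite -subr_eq0; apply/eqP; apply: iK => i; case: (e i).
Qed.

Lemma finite_classes : exists F : set family, finite_set F /\
  forall K, cartan c K -> exists2 K', F K' & cartan c K' /\ Aconj c K' K.
Proof.
apply: (dm_quot Hdim HM (k := (n * d + al)%N)).
- by apply: dset_cartan; exact: dmap_id.
- exact: dset_Aconj.
- exact: Aconj_equiv.
- exact: dm_cartan.
- exact: dm_class.
Qed.

Lemma almost_derivation_cartan (f : g -> A) (D : set g) : f 0 = 0 -> fcov D setT ->
  (forall x, D x -> exists H, [/\ additive_subgroup H, finite_index H &
    forall y, H y -> f (lie x y) = act x (f y) - act y (f x)]) ->
  exists2 K : family, cartan c K & exists H, [/\ additive_subgroup H, finite_index H &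
    forall x, H x -> nullc c K (x, f x)].
Proof.
move=> f0 /exists_injective_tuple[k [ik kD]] der.
have /choice[H hH] := fun i => der _ (kD i).
have [|||cK hK] := derivation_cartan g_nil H0 f0 ik (H := H); try by move=> i; case: (hH i).
by exists [ffun i => (k i, f (k i))].
Qed.
End Counting.

(** * Almost cohomology *)

Section AlmostInvariants.
Variables (g : lieRingType) (A : lieModType g).

Lemma almost_H0P (a : A) : almost_H0 A a <-> finite_set [set act x a | x in setT].
Proof.
rewrite /almost_H0 /= -[X in _ = X]/(C1_class (phom_zero g A)) C1_classP /=.
rewrite (_ : [set _ - _ | _ in _] = [set act x a | x in setT]) //.
by apply/seteqP; split=> y [x _ <-]; exists x; rewrite ?subr0.
Qed.

Lemma almost_H0B (a b : A) : almost_H0 A a -> almost_H0 A b -> almost_H0 A (a - b).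
Proof.
move=> /almost_H0P fa /almost_H0P fb; apply/almost_H0P.
apply: sub_finite_set (finite_image2 (fun u v => u - v) fa fb) => _ [x _ <-].
by exists (act x a); [exists x | exists (act x b); [exists x | rewrite actBr]].
Qed.

Lemma almost_H00 : almost_H0 A 0.
Proof.
apply/almost_H0P; apply: (@sub_finite_set _ _ [set 0]); last exact: finite_set1.
by move=> _ [x _ <-] /=; rewrite act0r.
Qed.

(** In [y (x a) = [y, x] a + x (y a)] both terms range over finite sets as [y] varies. *)
Lemma almost_H0_act x (a : A) : almost_H0 A a -> almost_H0 A (act x a).
Proof.
move=> /almost_H0P fa; apply/almost_H0P.
apply: sub_finite_set (finite_image2 (fun u v => u + v) fa (finite_image (act x) fa)).
move=> _ [y _ <-]; exists (act (lie y x) a); first by exists (lie y x).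
exists (act x (act y a)); first by exists (act y a) => //; exists y.
by rewrite act_lie subrK.
Qed.

Definition almost_H0_pred : {pred A} := fun a => `[< almost_H0 A a >].

Lemma almost_H0_zmod : zmod_closed almost_H0_pred.
Proof.
split=> [|a b /asboolP ha /asboolP hb]; apply/asboolP; first exact: almost_H00.
exact: almost_H0B.
Qed.

HB.instance Definition _ := GRing.isZmodClosed.Build A almost_H0_pred almost_H0_zmod.

Definition almost_quot := Quotient.quot almost_H0_pred.
HB.instance Definition _ := GRing.Zmodule.on almost_quot.

Definition quot_pi (a : A) : almost_quot := \pi_(Quotient.quot almost_H0_pred)%qT a.

Lemma quot_piP a b : quot_pi a = quot_pi b <-> almost_H0 A (a - b).
Proof.
split=> [e|h]; first by apply/asboolP; rewrite -[asbool _]/(_ \in almost_H0_pred) Quotient.idealrBE; apply/eqP.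
by apply/eqP; rewrite -[_ == _]Quotient.idealrBE; apply/asboolP.
Qed.

Lemma quot_piB a b : quot_pi (a - b) = quot_pi a - quot_pi b.
Proof. exact: raddfB. Qed.

Lemma quot_piD a b : quot_pi (a + b) = quot_pi a + quot_pi b.
Proof. exact: raddfD. Qed.

Lemma quot_pi_surj q : exists a, quot_pi a = q.
Proof. by exists (repr q); exact: reprK. Qed.

Definition quot_act (x : g) (q : almost_quot) : almost_quot := quot_pi (act x (repr q)).

Lemma quot_actE x a : quot_act x (quot_pi a) = quot_pi (act x a).
Proof.
apply/quot_piP; rewrite -actBr; apply: almost_H0_act; apply/quot_piP.
exact: (reprK (quot_pi a)).
Qed.

Lemma quot_actDl x y q : quot_act (x + y) q = quot_act x q + quot_act y q.
Proof. by have [a <-] := quot_pi_surj q; rewrite !quot_actE actDl quot_piD. Qed.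

Lemma quot_actDr x p q : quot_act x (p + q) = quot_act x p + quot_act x q.
Proof.
have [a <-] := quot_pi_surj p; have [b <-] := quot_pi_surj q.
by rewrite -quot_piD !quot_actE actDr quot_piD.
Qed.

Lemma quot_act_lie x y q :
  quot_act (lie x y) q = quot_act x (quot_act y q) - quot_act y (quot_act x q).
Proof. by have [a <-] := quot_pi_surj q; rewrite !quot_actE act_lie quot_piB. Qed.

HB.instance Definition _ := Zmodule_isLieModule.Build g almost_quot
  quot_actDl quot_actDr quot_act_lie.

Lemma act_quot_pi x a : act x (quot_pi a) = quot_pi (act x a).
Proof. exact: quot_actE. Qed.

(** If the values [act x a] are finitely many modulo a finite subgroup, they are finitely many. So
    one division by [almost_H0 A] is enough. *)
Lemma almost_quot_H0 (q : almost_quot) : finite_set (almost_H0 A) ->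
  finite_set [set act x q | x in [set: g]] -> q = 0.
Proof.
move=> fN; have [a <-] := quot_pi_surj q => fq.
have <- : quot_pi 0 = 0 by have := quot_piB 0 0; rewrite !subrr.
apply/quot_piP; rewrite subr0; apply/almost_H0P.
have [s sP] := choice quot_pi_surj.
apply: sub_finite_set (finite_image2 +%R (finite_image s fq) fN) => _ [x _ <-].
exists (s (quot_pi (act x a))); first by exists (quot_pi (act x a)) => //; exists x; rewrite // act_quot_pi.
exists (act x a - s (quot_pi (act x a))); first by apply/quot_piP; rewrite sP.
by rewrite addrC subrK.
Qed.
End AlmostInvariants.

(** * Definable modules and their quotients as sorts *)

Section Coding.
Variables (L : language) (M : structure L).

Lemma defpred_definable n (D : set (n.-tuple M)) : definable D ->
  defpred (fun e : 'I_n -> M => D [tuple e i | i < n]).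
Proof.
move=> [k [phi [a ->]]].
exists (n + k)%N, phi, (fun i : 'I_(n + k) =>
  match fintype.split i with inl j => inl j | inr j => inr (tnth a j) end) => e.
rewrite /defset /=; set u := [tuple of _]; set v := [tuple asg _ _ | _ < _].
suff -> : u = v by [].
apply: eq_from_tnth => i; rewrite tnth_mktuple -{1}(splitK i).
by case: (fintype.split i) => j /=; rewrite ?tnth_lshift ?tnth_rshift ?tnth_mktuple.
Qed.

Lemma defpred_eqvar (I : Type) (i j : I) : defpred (fun e : I -> M => e i = e j).
Proof.
exists 2%N, (fEq (tVar L ord0) (tVar L (lift ord0 ord0))),
  (fun k => inl (if k == ord0 then i else j)) => e /=.
by rewrite !tnth_mktuple.
Qed.

Definition sort_coding X n (cX : X -> n.-tuple M) (dX : definable_coding cX) : isort M X.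
Proof.
refine (@Sort L M X 'I_n (fun e x => e = tnth (cX x)) _ _ _).
- move=> e x y -> h; apply: dX.1; apply: eq_from_tnth => i.
  by rewrite h.
- by move=> x; exists (tnth (cX x)).
- apply: defpred_ext (defpred_and (defpred_reindex inl (defpred_definable dX.2))
    (defpred_allfin (fun i => defpred_eqvar (inl i) (inr i : 'I_n + 'I_n)))) => e.
  split=> [[[x _ ex] h]|[x [h1 h2]]].
    have e1 : (fun i => e (inl i)) = tnth (cX x).
      by apply/funext => i; rewrite ex tnth_mktuple.
    by exists x; split=> //; rewrite -e1; apply/funext => i; rewrite h.
  split; last by move=> i; rewrite -[LHS]/((fun i => e (inl i)) i) h1 -h2.
  by exists x => //; apply: eq_from_tnth => i; rewrite tnth_mktuple -h1.
Defined.

Lemma dmap_coding X Y Z n m p (cX : X -> n.-tuple M) (cY : Y -> m.-tuple M)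
    (cZ : Z -> p.-tuple M) (dX : definable_coding cX) (dY : definable_coding cY)
    (dZ : definable_coding cZ) (op : X -> Y -> Z) : definable_op cX cY cZ op ->
  @dmap L M _ _ (sort_prod (sort_coding dX) (sort_coding dY)) (sort_coding dZ)
    (fun q => op q.1 q.2).
Proof.
move=> dop; pose h (i : 'I_(n + m + p)) : ('I_n + 'I_m) + 'I_p :=
  match fintype.split i with inl j => inl (fintype.split j) | inr j => inr j end.
apply: defpred_ext (defpred_reindex h (defpred_definable dop)) => e; split.
  move=> [x [y exy]]; exists ((x, y), op x y) => /=.
  have E i : e (h i) = tnth [tuple of [tuple of cX x ++ cY y] ++ cZ (op x y)] i.
    by rewrite -exy tnth_mktuple.
  do 2!split; try split; apply/funext => i.
  - have := E (lshift p (lshift m i)); rewrite !tnth_lshift /h.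
    by rewrite (unsplitK (inl (lshift m i))) (unsplitK (inl i)).
  - have := E (lshift p (rshift n i)); rewrite tnth_lshift tnth_rshift /h.
    by rewrite (unsplitK (inl (rshift n i))) (unsplitK (inr i)).
  - have := E (rshift (n + m) i); rewrite tnth_rshift /h.
    by rewrite (unsplitK (inr i)).
move=> [[[x y] z] /= [[[ex ey] ez] exyz]]; exists x, y.
apply: eq_from_tnth => i; rewrite tnth_mktuple /h -{2}(splitK i).
case: (fintype.split i) => j /=; last by rewrite tnth_rshift exyz -ez.
rewrite tnth_lshift -{2}(splitK j).
case: (fintype.split j) => l /=; first by rewrite tnth_lshift -ex.
by rewrite tnth_rshift -ey.
Qed.

Lemma dzmod_add (V : zmodType) (sV : isort M V) :
  dmap (fun p : V * V => p.1 + p.2) -> dzmod V.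
Proof.
move=> dD; apply: dset_ext (dset_eq (f := fun q : (V * V) * V => q.2 + q.1.2)
  (h := fun q => q.1.1) _ _) => [[[x y] z] /=||].
- by split=> [<-|<-]; rewrite ?addrK ?subrK.
- apply: (dmap_comp dD (f := fun q => (q.2, q.1.2))); apply: dmap_pair; first exact: dmap_snd.
  exact: dmap_comp dmap_snd dmap_fst.
- exact: dmap_comp dmap_fst dmap_fst.
Qed.

Section Quotient.
Variables (g : lieRingType) (A : lieModType g) (sg : isort M g) (sA : isort M A).
Hypotheses (dA : dzmod A) (dact : dmap (fun p : g * A => act p.1 p.2)).
Hypothesis fN : finite_set (almost_H0 A).

(** The kernel is definable because it is finite, with its elements as parameters. *)
Let dker : dset (fun p : A * A => quot_pi p.1 = quot_pi p.2).
Proof.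
by apply: dset_ext (dset_pre (dset_fin fN) dA) => p; apply: iff_sym; exact: quot_piP.
Qed.

Definition sort_almost_quot : isort M (almost_quot A).
Proof.
apply: (@sort_quot _ _ _ sA _ (fun=> True) (@quot_pi g A) dset_True).
  by move=> q; have [a] := quot_pi_surj q; exists a.
by apply: dset_ext dker => p; split=> [|[]].
Defined.

(** Codes in the quotient are codes of representatives in [A], so a formula over [A] is used as it
    stands. *)
Lemma dzmod_almost_quot : dzmod (almost_quot A) (sV := sort_almost_quot).
Proof.
have d : dset (fun q : (A * A) * A => quot_pi (q.1.1 - q.1.2) = quot_pi q.2).
  apply: (dset_pre (f := fun q : (A * A) * A => (q.1.1 - q.1.2, q.2)) dker).
  by apply: dmap_pair; [exact: dmap_comp dA dmap_fst | exact: dmap_snd].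
apply: defpred_ext d => e; split.
  move=> [[[a b] c] /= [[[ca cb] cc] E]].
  exists ((quot_pi a, quot_pi b), quot_pi c) => /=; split; last by rewrite -E quot_piB.
  by split; [split; [exists a | exists b] | exists c].
move=> [[[p q] r] /= [[[[a [ca _] <-] [b [cb _] <-]] [c [cc _] <-]] E]].
by exists ((a, b), c); split=> //=; rewrite quot_piB.
Qed.

Lemma dmap_act_almost_quot :
  @dmap L M _ _ (sort_prod sg sort_almost_quot) sort_almost_quot
    (fun p : g * almost_quot A => act p.1 p.2).
Proof.
have d : dset (fun q : (g * A) * A => quot_pi (act q.1.1 q.1.2) = quot_pi q.2).
  apply: (dset_pre (f := fun q : (g * A) * A => (act q.1.1 q.1.2, q.2)) dker).
  by apply: dmap_pair; [exact: dmap_comp dact dmap_fst | exact: dmap_snd].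
apply: defpred_ext d => e; split.
  move=> [[[x b] c] /= [[[cx cb] cc] E]].
  exists ((x, quot_pi b), quot_pi c) => /=; split; last by rewrite -E act_quot_pi.
  by split; [split; [|exists b] | exists c].
move=> [[[x q] r] /= [[[cx [b [cb _] <-]] [c [cc _] <-]] E]].
by exists ((x, b), c); split=> //=; rewrite -act_quot_pi.
Qed.
End Quotient.
End Coding.

Lemma lie_nilpotent_foldr (g : lieRingType) : lie_nilpotent g ->
  exists c, (0 < c)%N /\ forall (w : seq g) y, size w = c -> foldr (@lie g) y w = 0.
Proof.
(* The successor keeps [c] positive even if [g] is zero and its chain has length 0. *)
move=> [n [I [I0 In _ _ HI]]]; exists n.+1; split=> // w y.
have H (v : seq g) : (size v <= n)%N -> I (size v) (foldr (@lie g) y v).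
  elim: v => [|x v IH] /=; first by rewrite I0.
  by move=> h; apply: HI => //; apply: IH; exact: ltnW.
case: w => //= x w [sw]; have := H w; rewrite sw In => /(_ (leqnn n)) ->.
exact: lie0r.
Qed.

(** * Coboundaries, cosets and the final count *)

Section Cohomology.
Variables (g : lieRingType) (A : lieModType g).

Lemma pmap0 (f : partial_hom g A) : f 0 = 0.
Proof.
have f0 := pdom_subgroup f; apply: (addrI (f 0)).
by rewrite -pmapD ?addr0 //; case: f0.
Qed.

Lemma pmapB (f : partial_hom g A) x y : pdom f x -> pdom f y -> f (x - y) = f x - f y.
Proof.
move=> fx fy; have fxy : pdom f (x - y) by exact: (pdom_subgroup f).2.
by apply/eqP; rewrite eq_sym subr_eq -pmapD // subrK.
Qed.

Lemma Dder2_sub (f : partial_hom g A) x : additive_subgroup (Dder2 f x).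
Proof.
have f0 : pdom f 0 by case: (pdom_subgroup f).
split=> [|y z [fy fxy ey] [fz fxz ez]].
  by split; rewrite ?lie0r // !pmap0 act0r act0l subrr.
split; rewrite ?lieBr ?pmapB //; try exact: (pdom_subgroup f).2.
by rewrite ey ez actBr actBl subrACA.
Qed.

Lemma Dder0 (f : partial_hom g A) : Dder f 0.
Proof.
have f0 : pdom f 0 by case: (pdom_subgroup f).
split=> //; rewrite (_ : Dder2 f 0 = pdom f); first exact: pdom_finite_index.
apply/seteqP; split=> y; first by case.
by move=> fy; split; rewrite ?lie0l ?pmap0 // act0l act0r subrr.
Qed.

Lemma almost_dD (a b : A) : almost_d (a + b) = almost_d a + almost_d b.
Proof.
rewrite -[RHS]/(C1_add _ _) /almost_d C1_addE.
by apply: C1_class_ext => x _ _ /=; rewrite actDr.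
Qed.

Lemma coset_range_almost_d (u : almost_C1 g A) a :
  [set u + almost_d a + h | h in range (@almost_d g A)] =
  [set u + h | h in range (@almost_d g A)].
Proof.
apply/seteqP; split=> _ [_ [b _ <-] <-].
  by exists (almost_d (a + b)); [exists (a + b) | rewrite almost_dD addrA].
exists (almost_d (- a + b)); first by exists (- a + b).
by rewrite -addrA -almost_dD addNKr.
Qed.

(** Undoes the division by the finite subgroup [almost_H0 A]: a difference with values in it is
    negligible in [almost_C1]. *)
Lemma C1_class_coboundary (f f' : partial_hom g A) (a : A) (H : set g) :
  finite_set (almost_H0 A) -> additive_subgroup H -> finite_index H ->
  (forall x, H x -> pdom f x -> pdom f' x -> almost_H0 A (f x + act x a - f' x)) ->
  C1_class f + almost_d a = C1_class f'.
Proof.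
move=> fN sH fH h; rewrite -[LHS]/(C1_add _ _) /almost_d C1_addE.
apply/C1_classP; pose F := phom_add (phom_add f (inner_phom a)) (phom_opp f').
apply: (@finite_image_phom _ _ F H) => //.
apply: sub_finite_set fN => _ [x [[[fx _] f'x] Hx] <-]; exact: h.
Qed.
End Cohomology.

Theorem theorem1p4 (L : language) (T : theory L) (M : structure L)
    (g : lieRingType) (A : lieModType g) :
  finite_dimensional T -> models T M -> definable_lie_module M A ->
  lie_nilpotent g ->
  finite_set (almost_H0 A) ->
  finite_set (almost_H1 A).
Proof.
move=> [dim Hdim] HM [n [m [cg [cA [dcg dcA addg lieg addA actA]]]]].
move=> /lie_nilpotent_foldr[c [c_gt0 g_nil]] fN.
pose sg := sort_coding dcg; pose sA := sort_coding dcA.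
have dg : dzmod g (sV := sg) by apply: dzmod_add; exact: (dmap_coding dcg dcg dcg addg).
have dA : dzmod A (sV := sA) by apply: dzmod_add; exact: (dmap_coding dcA dcA dcA addA).
have dlie := dmap_coding dcg dcg dcg lieg.
have dact := dmap_coding dcg dcA dcA actA.
pose B := almost_quot A; pose sB : isort M B := sort_almost_quot dA fN.
have dB : dzmod B (sV := sB) by exact: dzmod_almost_quot.
have dactB := dmap_act_almost_quot dA dact fN.
have H0 (q : B) : finite_set [set act x q | x in [set: g]] -> q = 0 by exact: almost_quot_H0.
have [F [finF FP]] := finite_classes Hdim HM dg dB dlie dactB c_gt0 g_nil H0.
pose rel (f : partial_hom g A) K := F K /\ exists K', [/\ cartan c K', Aconj c K K' &
  exists H, [/\ additive_subgroup H, finite_index H &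
    forall x, H x -> nullc c K' (x, quot_pi (f x))]].
have relF f : almost_derivation f -> exists K, rel f K.
  move=> df; pose fq x : B := quot_pi (f x).
  have [||x [fx fi]|K' cK' hK'] :=
    almost_derivation_cartan Hdim HM dg dactB g_nil H0 (f := fq) (D := Dder f).
  - by rewrite /fq pmap0; have := quot_piB (0 : A) 0; rewrite !subrr.
  - by apply: finite_index_fcov => //; exact: Dder0.
  - exists (Dder2 f x); split=> //; first exact: Dder2_sub.
    by move=> y [_ _ e]; rewrite /fq e quot_piB !act_quot_pi.
  by have [K FK [cK KK']] := FP K' cK'; exists K; split=> //; exists K'.
(* The null components of the two derivations are conjugate by some [q]. Over a common [x], the
   shifted point of the first graph and the point of the second lie in one null component, so they
   coincide; a lift [a] of [q] gives the coboundary. *)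
have relC f f' K : rel f K -> rel f' K -> exists a, C1_class f + almost_d a = C1_class f'.
  move=> [_ [K1 [cK1 KK1 [H1 [sH1 fH1 h1]]]]] [_ [K2 [[iK2 _] KK2 [H2 [sH2 fH2 h2]]]]].
  have [q hq] := Aconj_common KK1 KK2.
  have [a aq] := quot_pi_surj q; exists a.
  apply: (C1_class_coboundary fN (additive_subgroupI sH1 sH2) (finite_indexI fH1 fH2)).
  move=> x [H1x H2x] _ _; apply/quot_piP; rewrite quot_piD -act_quot_pi aq.
  have /hq h := h1 x H1x.
  by have /(congr1 snd) := nullc_inj2 iK2 h (h2 x H2x) erefl.
have coset K : exists S, forall f, rel f K ->
    [set C1_class f + h | h in range (@almost_d g A)] = S.
  have [[f fK]|nf] := pselect (exists f, rel f K); last first.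
    by exists set0 => f fK; case: nf; exists f.
  exists [set C1_class f + h | h in range (@almost_d g A)] => f' f'K.
  by have [a <-] := relC _ _ _ fK f'K; exact: coset_range_almost_d.
have [S SP] := choice coset.
apply: sub_finite_set (finite_image S finF) => _ [_ [f df <-] <-].
by have [K fK] := relF f df; exists K; [case: fK | rewrite (SP K f fK)].
Qed.
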